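(* Let $m,n\ge 2$ be integers that are not powers of the same integer, and let $X,Y\subseteq[0,1]$ be nonempty closed sets which are invariant under $T_m$ and $T_n$, respectively. Then for every real $t\neq 0$, $$\dim(X+tY)=\min\{1,\dim X+\dim Y\}.$$
   Context: $\dim$ denotes Hausdorff dimension of a set. For an integer $k\ge 2$, $T_k:x\mapsto kx \bmod 1$ is the $k$-fold map of the unit interval; a set $A$ is invariant under $T_k$ if $T_k(A)\subseteq A$. $X+tY=\{x+ty: x\in X,\ y\in Y\}$. *)

(* Defs.v *)
From HB Require Import structures.
From mathcomp Require Import all_boot all_order all_algebra.
From mathcomp Require Import all_classical all_reals all_analysis.

Set Implicit Arguments.
Unset Strict Implicit.
Unset Printing Implicit Defensive.

Import Order.TTheory GRing.Theory Num.Theory.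
Import numFieldNormedType.Exports.

Local Open Scope classical_set_scope.
Local Open Scope ring_scope.

(* [diam set0] is -oo, the supremum of the empty set in [\bar R]. *)
Definition diam (R : realType) (U : set R) : \bar R :=
  ereal_sup [set `|x - y|%:E | x in U & y in U].

(* The empty set weighs 0 for every s, including s = 0; a singleton weighs 1
   when s = 0 because 0 `^ 0 = 1, so that s = 0 yields the counting measure. *)
Definition diam_pow (R : realType) (s : R) (U : set R) : \bar R :=
  if U == set0 then 0%E else poweR (diam U) s.

(* Covers by finitely many sets are included, padded
   with empty sets. *)
Definition delta_cover (R : realType) (delta : R) (A : set R) :
    set (nat -> set R) :=
  [set U | A `<=` \bigcup_i U i /\ forall i, (diam (U i) <= delta%:E)%E].

Definition hausdorff_content (R : realType) (s delta : R) (A : set R) : \bar R :=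
  ereal_inf [set (\sum_(0 <= i <oo) diam_pow s (U i))%E
            | U in delta_cover delta A].

(* The content is nonincreasing in delta, so the supremum is the limit as
   delta tends to 0 from the right. *)
Definition hausdorff_measure (R : realType) (s : R) (A : set R) : \bar R :=
  ereal_sup [set hausdorff_content s delta A | delta in [set d : R | 0 < d]].

Definition hausdorff_dim (R : realType) (A : set R) : \bar R :=
  ereal_inf [set s%:E | s in [set s : R | 0 <= s /\ hausdorff_measure s A = 0%E]].

(* x |-> k x mod 1, with values in [0, 1[; in particular 1 is sent to 0. *)
Definition times_map (R : realType) (k : nat) (x : R) : R :=
  k%:R * x - (Num.floor (k%:R * x))%:~R.

Definition times_invariant (R : realType) (k : nat) (A : set R) : Prop :=
  times_map k @` A `<=` A.

Definition powers_of_same_integer (m n : nat) : Prop :=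
  exists (c : int) (i j : nat), m%:Z = c ^+ i /\ n%:Z = c ^+ j.

(* Main.v *)
Require Import Defs.
From HB Require Import structures.
From mathcomp Require Import all_boot all_order all_algebra.
From mathcomp Require Import all_classical all_reals all_analysis.
From mathcomp Require Import ring lra zify.

Import Order.TTheory GRing.Theory Num.Theory.
Import numFieldNormedType.Exports.

Local Open Scope classical_set_scope.
Local Open Scope ring_scope.

(** The upper bound follows from the equality of the Hausdorff and box dimensions
    of [X] and [Y].  For the lower bound, put [M = m^q] and compare two counts of
    the words of length [K] (in base [M]) of [X] times [Y].  By submultiplicativity
    there are at least about [M^(K (dim X + dim Y))] of them.  On the other hand, a
    cover of [X + t Y] of small [s]-dimensional weight yields a code.  Read along a
    path [(x, y)], the blocks see the projections [x + t n^u y], where the phase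
    [u] rotates by [ln M / ln n] modulo 1.  Whenever the phase is almost 0, the
    invariance of [X] and [Y] lets one use the original cover again: name the
    element of the cover containing the zoomed projection, which costs [s ln M]
    per block until the scale of that element is reached.  Given this, each block
    is known up to the words having nearly the same projection.  By the pointwise
    form of Marstrand's theorem, for every path and block their number is at most
    about [M^max(0, dim X + dim Y - 1)] for all but a small proportion of phases;
    averaging over the initial phase, most paths see few exceptional blocks.
    Returns of the phase near 0 have bounded gaps because [ln m / ln n] is
    irrational, so the waiting times between two uses of the cover are negligible.
    Comparing the two counts gives
    [dim X + dim Y <= s + max(0, dim X + dim Y - 1)]. *)

Set Implicit Arguments.
Unset Strict Implicit.
Unset Printing Implicit Defensive.

(** * Digits and words *)

Section Digits.
Variable R : realType.
Implicit Types (x y z : R) (N k : nat) (Z : set R).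

Definition fr x : R := x - (Num.floor x)%:~R.

Lemma fr_ge0 x : 0 <= fr x.
Proof. by rewrite /fr subr_ge0 floor_le. Qed.

Lemma fr_lt1 x : fr x < 1.
Proof. by have := floorD1_gt x; rewrite /fr intrD; lra. Qed.

Lemma frDz x (z : int) : fr (x + z%:~R) = fr x.
Proof. by rewrite /fr floorDrz ?intr_int// intrKfloor intrD; lra. Qed.

Lemma frDn x k : fr (k%:R + x) = fr x.
Proof. by rewrite addrC -[k%:R]/((k%:Z)%:~R) frDz. Qed.

Lemma fr_id x : 0 <= x -> x < 1 -> fr x = x.
Proof.
move=> x0 x1; rewrite /fr (@floor_def _ x 0) ?subr0//.
by rewrite x0 /= add0r.
Qed.

(* For [N = b ^ k] and [x] in [0, 1[, [dg N x] encodes the first [k] digits of [x]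
   in base [b], and [ws N Z] lists the words of length [k] occurring in [Z]. *)
Definition dg N x : nat := Num.truncn (N%:R * x).

Lemma dgE N x : 0 <= x -> N%:R * x = (dg N x)%:R + fr (N%:R * x).
Proof.
move=> x0; have Nx : 0 <= N%:R * x by rewrite mulr_ge0.
rewrite /dg /fr truncn_floor Nx.
have : 0 <= Num.floor (N%:R * x) by rewrite floor_ge0.
case: (Num.floor (N%:R * x)) => // k _; rewrite absz_nat.
by rewrite addrC -[(Posz k)%:~R]/(k%:R : R) subrK.
Qed.

Lemma dg_uniq N x k (f : R) : 0 <= x -> 0 <= f -> f < 1 ->
  N%:R * x = k%:R + f -> dg N x = k.
Proof.
move=> x0 f0 f1 e; apply: truncn_def; rewrite e -natr1; apply/andP; split; lra.
Qed.

Lemma dg_lt N x : (0 < N)%N -> 0 <= x -> x < 1 -> (dg N x < N)%N.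
Proof.
move=> N0 x0 x1; rewrite -(ltr_nat R); have := dgE N x0.
have := fr_ge0 (N%:R * x); have : N%:R * x < N%:R :> R.
  by rewrite gtr_pMr// ltr0n.
lra.
Qed.

Lemma frM N N' x : 0 <= x -> fr (N'%:R * fr (N%:R * x)) = fr ((N * N')%:R * x).
Proof.
move=> x0; have e := dgE N x0.
have -> : (N * N')%:R * x = (N' * dg N x)%:R + N'%:R * fr (N%:R * x).
  by rewrite !natrM mulrC mulrA [x * _]mulrC {1}e; ring.
by rewrite frDn.
Qed.

Lemma dgM N N' x : 0 <= x ->
  dg (N * N') x = (N' * dg N x + dg N' (fr (N%:R * x)))%N.
Proof.
move=> x0; have e := dgE N x0.
have e' := dgE N' (fr_ge0 (N%:R * x)).
apply: (@dg_uniq _ _ _ (fr (N'%:R * fr (N%:R * x)))); rewrite ?fr_ge0 ?fr_lt1//.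
rewrite natrD -addrA -e' !natrM mulrC mulrA [x * _]mulrC {1}e; ring.
Qed.

Lemma dg_approx N x : (0 < N)%N -> 0 <= x ->
  `|x - (dg N x)%:R / N%:R| <= N%:R^-1.
Proof.
move=> N0 x0; have Nx : 0 < N%:R :> R by rewrite ltr0n.
have -> : x - (dg N x)%:R / N%:R = fr (N%:R * x) / N%:R.
  have e := dgE N x0; apply: (mulIf (lt0r_neq0 Nx)).
  by rewrite mulrBl !divfK ?gt_eqF// mulrC; lra.
rewrite normrM (ger0_norm (fr_ge0 _)) normfV gtr0_norm//.
by rewrite ler_piMl ?invr_ge0 ?ltW// fr_lt1.
Qed.

Definition ws N Z : seq nat :=
  [seq i <- iota 0 N | `[< exists2 z, Z z & dg N z = i >]].

Definition cnt N Z : nat := size (ws N Z).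

Lemma ws_uniq N Z : uniq (ws N Z).
Proof. by rewrite filter_uniq// iota_uniq. Qed.

Lemma wsP N Z i : i \in ws N Z -> exists2 z, Z z & dg N z = i.
Proof. by rewrite mem_filter => /andP[/asboolP]. Qed.

Lemma ws_lt N Z i : i \in ws N Z -> (i < N)%N.
Proof. by rewrite mem_filter mem_iota add0n => /andP[_]. Qed.

Definition unit_set Z := Z `<=` [set x | 0 <= x < 1].

Lemma ws_mem N Z z : (0 < N)%N -> unit_set Z -> Z z -> dg N z \in ws N Z.
Proof.
move=> N0 Z1 Zz; have /andP[z0 z1] := Z1 _ Zz.
rewrite mem_filter mem_iota leq0n add0n dg_lt// !andbT.
by apply/asboolP; exists z.
Qed.

Lemma cnt_le N Z : (cnt N Z <= N)%N.
Proof. by rewrite /cnt size_filter -[leqRHS](size_iota 0) count_size. Qed.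

Lemma cnt_gt0 N Z : (0 < N)%N -> unit_set Z -> Z !=set0 -> (0 < cnt N Z)%N.
Proof. by move=> N0 Z1 [z /(@ws_mem N) -/(_ N0 Z1)]; rewrite /cnt; case: ws. Qed.

Definition stable N Z := forall z, Z z -> Z (fr (N%:R * z)).

Lemma stableX N Z k : unit_set Z -> stable N Z -> stable (N ^ k) Z.
Proof.
move=> Z1 ZN; elim: k => [|k IH] z Zz; have /andP[z0 z1] := Z1 _ Zz.
  by rewrite expn0 mul1r fr_id.
by rewrite expnSr -frM//; apply/ZN/IH.
Qed.

(** Cutting a word after its first part leaves a word of [Z] on the right, by stability, and the two
    parts determine the whole. *)
Lemma cntM N N' Z : (0 < N)%N -> (0 < N')%N -> unit_set Z -> stable N Z ->
  (cnt (N * N') Z <= cnt N Z * cnt N' Z)%N.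
Proof.
move=> N0 N'0 Z1 ZN.
rewrite /cnt -(size_allpairs (fun i j => N' * i + j)%N).
apply: uniq_leq_size (ws_uniq _ _) _ => w /wsP[z Zz <-].
have /andP[z0 z1] := Z1 _ Zz.
rewrite dgM//; apply/allpairsP; exists (dg N z, dg N' (fr (N%:R * z))).
by split => //=; apply: ws_mem => //; apply: ZN.
Qed.

Lemma cntX N k Z : (0 < N)%N -> unit_set Z -> stable N Z ->
  (cnt (N ^ k) Z <= cnt N Z ^ k)%N.
Proof.
move=> N0 Z1 ZN; elim: k => [|k IH]; first by rewrite expn0 cnt_le.
rewrite !expnS (leq_trans (cntM _ _ _ _))// ?expn_gt0 ?N0//.
by rewrite leq_mul2l IH orbT.
Qed.

(* Three integers suffice since [u - 2 < i <= u + 1]. *)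
Lemma mem_near_digit (u f : R) (i : nat) : 0 <= f -> f < 1 ->
  `|u - (i%:R + f)| <= 1 -> i \in iota (Num.truncn (u - 1)) 3.
Proof.
move=> f0 f1; rewrite ler_norml => /andP[h1 h2].
set k := Num.truncn _.
have k1 : u - 1 < k%:R + 1 by rewrite natr1 truncnS_gt.
rewrite mem_iota; apply/andP; split; last first.
  by rewrite -(ltr_nat R) natrD; lra.
have [c1|c1] := leP 0 (u - 1).
  have : k%:R <= u - 1 by rewrite truncn_le.
  move=> k2; rewrite -ltnS -(ltr_nat R) -natr1; lra.
suff -> : k = 0%N by [].
by apply/eqP; rewrite -leqn0 truncn_le_nat; lra.
Qed.

Lemma dg_near N z (c r : R) : (0 < N)%N -> 0 <= z -> N%:R * r <= 1 ->
  `|z - c| <= r -> dg N z \in iota (Num.truncn (N%:R * c - 1)) 3.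
Proof.
move=> N0 z0 Nr zc.
apply: (@mem_near_digit _ (fr (N%:R * z))); rewrite ?fr_ge0 ?fr_lt1//.
rewrite -dgE// -mulrBr normrM distrC gtr0_norm ?ltr0n//.
by rewrite (le_trans _ Nr)// ler_pM2l// ltr0n.
Qed.

(** The ball determines the first part of the word up to three values, and the second part is again
    a word of [Z]. *)
Lemma count_ball N N' Z (c : R) : (0 < N)%N -> (0 < N')%N ->
  unit_set Z -> stable N Z ->
  (count (fun w : nat => (`|c - w%:R / (N * N')%:R| <= N%:R^-1)%R) (ws (N * N') Z)
    <= 3 * cnt N' Z)%N.
Proof.
move=> N0 N'0 Z1 ZN.
rewrite -size_filter /cnt -(size_iota (Num.truncn (N%:R * c - 1)) 3).
rewrite -(size_allpairs (fun i j => N' * i + j)%N).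
apply: uniq_leq_size => [|w]; first by rewrite filter_uniq// ws_uniq.
rewrite mem_filter => /andP[hc /wsP[z Zz ew]].
have /andP[z0 z1] := Z1 _ Zz.
move: hc; rewrite -{}ew dgM// => hc.
suff hi : dg N z \in iota (Num.truncn (N%:R * c - 1)) 3.
  apply/allpairsP; exists (dg N z, dg N' (fr (N%:R * z))).
  by split => //; apply: ws_mem => //; apply: ZN.
set i := dg N z in hc *.
set j := dg N' _ in hc.
have j1 : (j < N')%N by apply: dg_lt; rewrite ?fr_ge0 ?fr_lt1.
have Ngt : 0 < N%:R :> R by rewrite ltr0n.
have N'gt : 0 < N'%:R :> R by rewrite ltr0n.
apply: (@mem_near_digit _ (j%:R / N'%:R)); first by rewrite divr_ge0.
  by rewrite ltr_pdivrMr ?ltr0n// mul1r ltr_nat.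
have -> : N%:R * c - (i%:R + j%:R / N'%:R)
    = N%:R * (c - (N' * i + j)%:R / (N * N')%:R).
  by rewrite natrD !natrM; field; rewrite !gt_eqF.
by rewrite normrM gtr0_norm// mulrC -ler_pdivlMr// div1r.
Qed.

Definition logr N (r : R) : nat := trunc_log N (Num.truncn r^-1).

(** Truncating [r^-1] loses nothing, since the powers of [N] are integers. *)
Lemma logrP N (r : R) : (1 < N)%N -> 0 < r -> r <= 1 ->
  (N ^ logr N r)%:R * r <= 1 /\ 1 < (N ^ (logr N r).+1)%:R * r.
Proof.
move=> N1 r0 r1; have i1 : 1 <= r^-1 by rewrite invf_ge1.
have := @trunc_log_bounds N (Num.truncn r^-1) N1.
rewrite truncn_gt0 i1 => /(_ isT)/andP[h1 h2]; split.
  rewrite -ler_pdivlMr// div1r; apply: le_trans (_ : (Num.truncn r^-1)%:R <= _).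
    by rewrite ler_nat.
  by rewrite truncn_le invr_ge0 ltW.
rewrite -ltr_pdivrMr// div1r; apply: lt_le_trans (truncnS_gt _) _.
by rewrite ler_nat.
Qed.

End Digits.

(** * Hausdorff dimension and finite covers *)

Section HausdorffCovers.
Variable R : realType.
Implicit Types (s d e : R) (A U : set R) (B : seq (R * R)).

Definition covers B A := forall x, A x -> exists2 b, b \in B & `|x - b.1| <= b.2.

(** On compact sets and for [s > 0] this amounts to the vanishing of the [s]-dimensional Hausdorff
    measure. The coding needs finitely many scales and logarithms of radii, hence finite covers and
    positive radii. *)
Definition small_cover s A := forall d e, 0 < d -> 0 < e ->
  exists B, [/\ forall b, b \in B -> 0 < b.2 <= d, covers B A
    & \sum_(b <- B) b.2 `^ s <= e].

Lemma small_coverS s A A' : A `<=` A' -> small_cover s A' -> small_cover s A.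
Proof.
move=> AA' H d e d0 e0; have [B [h1 h2 h3]] := H d e d0 e0.
by exists B; split => // x /AA' /h2.
Qed.

Lemma diam_leP U d : (diam U <= d%:E)%E <->
  (forall x y, U x -> U y -> `|x - y| <= d).
Proof.
split=> [/ereal_supP H x y Ux Uy|H].
  by rewrite -lee_fin; apply: H; exists x => //; exists y.
by apply/ereal_supP => _ [x Ux [y Uy <-]]; rewrite lee_fin H.
Qed.

Lemma diam_ge0 U : U !=set0 -> (0 <= diam U)%E.
Proof.
move=> [x Ux]; apply: ereal_sup_ubound; exists x => //; exists x => //.
by rewrite subrr normr0.
Qed.

Lemma diam_pow_ge0 s U : (0 <= diam_pow s U)%E.
Proof. by rewrite /diam_pow; case: ifP => // _; exact: poweR_ge0. Qed.

Lemma hausdorff_content_ge0 s d A : (0 <= hausdorff_content s d A)%E.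
Proof.
apply/ereal_infP => _ [U _ <-]; apply: nneseries_ge0 => i _ _.
exact: diam_pow_ge0.
Qed.

Lemma small_cover_measure0 s A : 0 < s -> small_cover s A ->
  hausdorff_measure s A = 0%E.
Proof.
move=> s0 H; apply/eqP; rewrite eq_le; apply/andP; split; last first.
  rewrite (le_trans (hausdorff_content_ge0 s 1 A))//.
  by apply: ereal_sup_ubound; exists 1 => //=.
apply/ereal_supP => _ [d /= d0 <-].
apply/lee_addgt0Pr => e e0; rewrite add0e.
have p2 : 0 < 2 `^ s :> R by rewrite powR_gt0.
(* A ball of radius [r] has diameter at most [2 r]. *)
have [||B [h1 h2 h3]] := H (d / 2) (e / 2 `^ s); rewrite ?divr_gt0//.
pose U i := if (i < size B)%N then
  let b := nth (0, 0) B i in [set x | `|x - b.1| <= b.2] else set0.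
have bB i : (i < size B)%N -> nth (0, 0) B i \in B by exact: mem_nth.
have dU i : (i < size B)%N -> (diam (U i) <= (2 * (nth (0, 0) B i).2)%:E)%E.
  move=> iB; rewrite /U iB; apply/diam_leP => x y /= hx hy.
  rewrite (le_trans (ler_distD (nth (0,0) B i).1 _ _))// mulr_natl mulr2n.
  by rewrite lerD// distrC.
apply: ge_ereal_inf; exists (\sum_(0 <= i <oo) diam_pow s (U i))%E.
  exists U => //; split.
    move=> x /h2[b /(nthP (0, 0))[i iB <-] hx]; exists i => //.
    by rewrite /U iB.
  move=> i; have [iB|iB] := ltnP i (size B).
    rewrite (le_trans (dU _ iB))// lee_fin.
    have /andP[_] := h1 _ (bB _ iB); lra.
  rewrite /U ltnNge iB /=; apply/diam_leP => x y //.
rewrite (nneseries_split 0 (size B)); last by move=> k _; exact: diam_pow_ge0.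
rewrite add0n [X in (_ + X)%E]eseries0 ?adde0; last first.
  by move=> i iB _; rewrite /diam_pow /U ltnNge iB /= eqxx.
apply: (@le_trans _ _ (\sum_(0 <= k < size B)
   ((2 `^ s) * (nth (0, 0) B k).2 `^ s)%:E)%E).
  rewrite big_nat [in leRHS]big_nat; apply: lee_sum => i /= iB.
  rewrite /diam_pow; case: ifPn => [_|Un0].
    by rewrite lee_fin mulr_ge0// powR_ge0.
  have /andP[r0 _] := h1 _ (bB _ iB).
  rewrite -powRM//; last exact: ltW.
  rewrite -poweR_EFin; apply: gt0_ler_poweR; rewrite ?(ltW s0)//.
  - by rewrite in_itv /= leey andbT diam_ge0//; exact/set0P.
  - by rewrite in_itv /= leey andbT lee_fin mulr_ge0// ltW.
  - exact: dU.
rewrite sumEFin lee_fin -mulr_sumr -[leRHS](divfK (lt0r_neq0 p2)) mulrC.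
rewrite ler_pM2r// (le_trans _ h3)//.
by rewrite (big_nth (0,0)).
Qed.

(** Each set of a countable cover is enlarged to an open ball, the excess radii having small total
    weight, and compactness leaves finitely many balls. *)
Lemma measure0_small_cover s' s A : 0 <= s' -> s' <= s -> 0 < s -> compact A ->
  hausdorff_measure s' A = 0%E -> small_cover s A.
Proof.
move=> s'0 s's s0 cA H0 d e d0 e0.
have p2 : 0 < 2 `^ s :> R by rewrite powR_gt0.
pose e1 := e / 2 `^ s / 2; have e10 : 0 < e1 by rewrite !divr_gt0.
(* Diameters at most 1 let the exponent grow from [s'] to [s]; [d / 2] leaves room for the excess
   [E i <= dd]. *)
pose dd := Num.min 1 (d / 2).
have dd0 : 0 < dd by rewrite lt_min ltr01 divr_gt0.
have dd1 : dd <= 1 by rewrite ge_min lexx.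
have ddd : dd <= d / 2 by rewrite ge_min lexx orbT.
have : (hausdorff_content s' dd A < e1%:E)%E.
  apply: (@le_lt_trans _ _ 0%E); last by rewrite lte_fin.
  by rewrite -H0; apply: ereal_sup_ubound; exists dd.
move/ereal_inf_lt => [_ [U [AU dU] <-] Ue].
pose D i : R := if U i == set0 then 0 else fine (diam (U i)).
have DE i : U i !=set0 -> diam (U i) = (D i)%:E.
  move=> U0; rewrite /D; case: eqP => [e'|_]; first by move: U0 => [x]; rewrite e'.
  rewrite fineK// fin_numE; have := dU i; have := diam_ge0 U0.
  by case: (diam (U i)).
have D0 i : 0 <= D i.
  have [e'|/set0P U0] := eqVneq (U i) set0; first by rewrite /D e' eqxx.
  by rewrite -lee_fin -DE// diam_ge0.
have D1 i : D i <= dd.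
  have [e'|/set0P U0] := eqVneq (U i) set0.
    by rewrite /D e' eqxx ltW.
  by rewrite -lee_fin -DE.
pose E i : R := Num.min dd ((e1 * 2^-1 ^+ i.+1) `^ s^-1).
have E0 i : 0 < E i.
  by rewrite lt_min dd0 powR_gt0// mulr_gt0// exprn_gt0// invr_gt0.
(* An empty [U i] gets the centre 0 and the radius [E i]; this extra ball costs only the weight of
   [E i]. *)
pose c i : R := xget 0 (U i).
pose r i : R := D i + E i.
have Ur i x : U i x -> ball (c i) (r i) x.
  move=> Ux; have U0 : U i !=set0 by exists x.
  have Uc : U i (c i) by rewrite /c; case: xgetP => [y _ //|/(_ x)].
  rewrite /ball /= (@le_lt_trans _ _ (D i)) ?ltrDl//.
  have /diam_leP : (diam (U i) <= (D i)%:E)%E by rewrite DE.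
  exact.
have := cA; rewrite compact_cover => /(_ nat setT (fun i => ball (c i) (r i))).
case => [i _|x /AU[i _ Ux]|D' _ AD'].
- exact: ball_open.
- by exists i => //; exact: Ur.
have [N NE] : exists N, forall i, i \in finmap.enum_fset D' -> (i < N)%N.
  exists (\max_(i <- finmap.enum_fset D') i).+1 => i iD'.
  by rewrite ltnS; exact: (@leq_bigmax_seq _ (finmap.enum_fset D') xpredT id i iD').
exists [seq (c i, r i) | i <- iota 0 N]; split.
- move=> b /mapP[i _ ->] /=; rewrite /r ltr_wpDl//= (le_trans _ (_ : dd + dd <= d))//.
    by rewrite lerD// ge_min lexx.
  by move: ddd; lra.
- move=> x /AD'[i iD' /= xi]; exists (c i, r i).
    by apply: (map_f (fun i => (c i, r i))); rewrite mem_iota add0n /=; exact: NE.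
  by rewrite distrC ltW.
rewrite big_map.
apply: (@le_trans _ _ (\sum_(i <- iota 0 N) 2 `^ s * (D i `^ s + E i `^ s))).
  apply: ler_sum => i _; rewrite /=.
  have x0 : 0 <= Num.max (D i) (E i) by rewrite le_max D0.
  apply: (@le_trans _ _ ((2 * Num.max (D i) (E i)) `^ s)).
    apply: ge0_ler_powR; rewrite ?nnegrE ?addr_ge0 ?(ltW (E0 _))//.
      by rewrite ltW.
    - by rewrite mulr_ge0.
    - by rewrite mulr_natl mulr2n lerD// le_max lexx ?orbT.
  rewrite powRM// ler_pM2l//.
  by have [_|_] := leP (D i) (E i); rewrite ?lerDl ?lerDr powR_ge0.
rewrite -mulr_sumr big_split /=.
have eE : e = 2 `^ s * (e1 + e1) by rewrite /e1; field; rewrite gt_eqF.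
rewrite [leRHS]eE ler_pM2l// lerD//.
  rewrite -lee_fin -sumEFin (le_trans _ (ltW Ue))//.
  apply: (@le_trans _ _ (\sum_(0 <= i < N) diam_pow s' (U i))%E); last first.
    by apply: nneseries_lim_ge => i _ _; exact: diam_pow_ge0.
  rewrite /index_iota subn0; apply: lee_sum => i _.
  have [e'|/set0P U0] := eqVneq (U i) set0.
    by rewrite /D /diam_pow e' eqxx powR0 ?gt_eqF.
  rewrite /diam_pow; case: eqP => [e'|_]; first by move: U0 => [x]; rewrite e'.
  rewrite DE// poweR_EFin lee_fin.
  have [Dz|Dz] := eqVneq (D i) 0.
    by rewrite Dz powR0 ?gt_eqF// powR_ge0.
  apply: ger_powR => //; rewrite lt_def Dz D0 /=.
  exact: le_trans (D1 _) dd1.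
apply: (@le_trans _ _ (\sum_(i <- iota 0 N) e1 * 2^-1 ^+ i.+1)).
  apply: ler_sum => i _.
  have q0 : 0 <= e1 * 2^-1 ^+ i.+1 by rewrite mulr_ge0 ?exprn_ge0// ltW.
  have -> : e1 * 2^-1 ^+ i.+1 = ((e1 * 2^-1 ^+ i.+1) `^ s^-1) `^ s.
    by rewrite -powRrM mulVf ?gt_eqF// powRr1.
  apply: ge0_ler_powR; rewrite ?nnegrE ?powR_ge0 ?(ltW (E0 _)) ?(ltW s0)//.
  by rewrite ge_min lexx orbT.
rewrite -mulr_sumr ler_piMr ?(ltW e10)//.
have -> : \sum_(i <- iota 0 N) (2^-1 : R) ^+ i.+1 = 1 - 2^-1 ^+ N.
  rewrite -{1}[N]subn0 -/(index_iota 0 N) {NE}.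
  elim: N => [|n IH]; first by rewrite big_geq// expr0 subrr.
  by rewrite big_nat_recr//= IH !exprS; field.
by rewrite gerBl exprn_ge0.
Qed.

End HausdorffCovers.

Section DimensionCounting.
Variable R : realType.
Implicit Types (s d e : R) (A : set R).

Lemma hausdorff_dim_char A (g : R) : 0 <= g -> compact A ->
  (forall s, g < s -> small_cover s A) ->
  (forall s, 0 < s -> s < g -> ~ small_cover s A) -> hausdorff_dim A = g%:E.
Proof.
move=> g0 cA hs hn; apply/eqP; rewrite eq_le; apply/andP; split.
  apply/lee_addgt0Pr => e e0; rewrite -EFinD; apply: ereal_inf_lbound.
  exists (g + e) => //=; split; first by rewrite addr_ge0// ltW.
  by apply: small_cover_measure0; [lra|apply: hs; lra].
apply/ereal_infP => _ [s /= [s0 Hs] <-]; rewrite lee_fin leNgt; apply/negP => sg.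
(* The midpoint is positive even when [s = 0], where [s] itself would not qualify. *)
apply: (hn ((s + g) / 2)); [lra|lra|].
by apply: (measure0_small_cover s0 _ _ cA Hs); lra.
Qed.

(** The total weight of such a cover is at most [C * r ^ (s - s1)], which tends to 0 with [r]. *)
Lemma small_cover_centers s s1 (C : R) A : 0 <= s1 -> s1 < s -> 0 < C ->
  (forall r0 : R, 0 < r0 -> exists r : R, [/\ 0 < r, r <= r0 & exists L : seq R,
    (forall x, A x -> exists2 c, c \in L & `|x - c| <= r) /\
    (size L)%:R * r `^ s1 <= C]) -> small_cover s A.
Proof.
move=> s10 s1s C0 H d e d0 e0.
have eC : 0 < e / C by rewrite divr_gt0.
have [|r [r0 rr [L [AL sL]]]] := H (Num.min d ((e / C) `^ (s - s1)^-1)).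
  by rewrite lt_min d0 powR_gt0.
exists [seq (c, r) | c <- L]; split.
- move=> b /mapP[c _ ->] /=; rewrite r0/=.
  by move: rr; rewrite le_min => /andP[].
- move=> x /AL[c cL hc]; exists (c, r) => //.
  exact: (map_f (fun c => (c, r))).
rewrite big_map /= big_const_seq count_predT iter_addr_0 -mulr_natl.
have -> : s = s1 + (s - s1) by lra.
rewrite powRD; last by apply/implyP => _; rewrite gt_eqF.
rewrite mulrA; apply: (@le_trans _ _ (C * (e / C))); last first.
  by rewrite mulrC divfK// gt_eqF.
apply: ler_pM => //; rewrite ?mulr_ge0 ?powR_ge0//.
have -> : e / C = ((e / C) `^ (s - s1)^-1) `^ (s - s1).
  by rewrite -powRrM mulVf ?powRr1 ?ltW// gt_eqF// subr_gt0.
apply: ge0_ler_powR; rewrite ?nnegrE ?powR_ge0 ?subr_ge0 ?(ltW s1s) ?(ltW r0)//.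
by move: rr; rewrite le_min => /andP[].
Qed.

Lemma small_cover_bounded A (b s : R) : 0 < b -> (forall x, A x -> `|x| <= b) ->
  1 < s -> small_cover s A.
Proof.
(* A grid of [N + 1] points with gap [2 b / N] has weight [2 b (N + 1) / N <= 4 b]. *)
move=> b0 Ab s1; apply: (@small_cover_centers _ 1 (4 * b)) => //; first by lra.
move=> r0 r00.
pose N := (Num.truncn (2 * b / r0)).+1.
have N0 : 0 < N%:R :> R by rewrite ltr0n.
have Nr : 2 * b / N%:R <= r0.
  rewrite ler_pdivrMr// [leRHS]mulrC -ler_pdivrMr//.
  by have /ltW := truncnS_gt (2 * b / r0).
have r1 : 0 < 2 * b / N%:R by rewrite divr_gt0// mulr_gt0.
exists (2 * b / N%:R); split => //.
exists [seq (i%:R * (2 * b / N%:R) - b) | i <- iota 0 N.+1]; split; last first.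
  rewrite size_map size_iota powRr1 ?(ltW r1)// mulrA ler_pdivrMr//.
  have : 1 <= N%:R :> R by rewrite ler1n.
  by rewrite -natr1; nra.
move=> x /Ab; rewrite ler_norml => /andP[x1 x2].
pose i := Num.truncn ((x + b) / (2 * b / N%:R)).
have u0 : 0 <= (x + b) / (2 * b / N%:R) by rewrite divr_ge0 ?(ltW r1)//; lra.
have /andP[i1 i2] := truncn_itv u0.
exists (i%:R * (2 * b / N%:R) - b).
  apply: (map_f (fun i : nat => i%:R * (2 * b / N%:R) - b)).
  rewrite mem_iota add0n /= ltnS -(ler_nat R) (le_trans i1)//.
  rewrite ler_pdivrMr// mulrC divfK ?gt_eqF//; lra.
move: i1 i2; rewrite ler_pdivlMr// ltr_pdivrMr// -natr1 => i1 i2.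
rewrite ler_norml; apply/andP; split; lra.
Qed.
End DimensionCounting.

(** * Word counts of invariant sets *)

Section BoxCounting.
Variable R : realType.
Implicit Types (s d e : R) (A Z : set R).

(* Furstenberg's argument: a cover by cylinders of total weight at most 1 bounds the
   count at level [k] by the counts at lower levels, since deleting a prefix leaves a
   word of [Z].  Each ball of the cover meets at most three cylinders. *)
Lemma cnt_upper (b : nat) Z s : (1 < b)%N -> unit_set Z -> stable b Z -> 0 < s ->
  small_cover s Z -> exists2 C : R, 0 < C &
  forall k, (cnt (b ^ k) Z)%:R <= C * (b ^ k)%:R `^ s.
Proof.
(* Radii at most [1 / b] make every [kk c] positive, so that the induction descends. In the weight,
   3 is for the cylinders met by a ball and [b ^ s] for rounding its radius to a power of [b]. *)
move=> b1 Z1 Zb s0 /(_ b%:R^-1 (3 * b%:R `^ s)^-1).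
have b0 : (0 < b)%N by exact: ltnW.
have bR : 0 < b%:R :> R by rewrite ltr0n.
have bs0 : 0 < b%:R `^ s :> R by rewrite powR_gt0.
have bk0 k : (0 < b ^ k)%N by rewrite expn_gt0 b0.
have bk1 k : 1 <= (b ^ k)%:R `^ s :> R.
  rewrite -[leLHS](powRr0 (b ^ k)%:R); apply: ler_powR; last exact: ltW.
  by rewrite ler1n.
rewrite !invr_gt0 mulr_gt0// => /(_ bR isT) [B [hB cB sB]].
pose kk (c : R * R) := logr b c.2.
have kkP c : c \in B -> [/\ 0 < c.2, (b ^ kk c)%:R * c.2 <= 1,
    1 < (b ^ (kk c).+1)%:R * c.2 & (0 < kk c)%N].
  move=> /hB /andP[c0 cb].
  have c1 : c.2 <= 1 by rewrite (le_trans cb)// invf_le1// ler1n.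
  have [h1 h2] := logrP b1 c0 c1; split=> //; rewrite lt0n; apply/eqP => k0.
  move: h2; rewrite -/(kk c) k0 expn1 ltNge.
  by rewrite mulrC -ler_pdivlMr// div1r cb.
pose L := (\max_(c <- B) kk c)%N.
have kL c : c \in B -> (kk c <= L)%N.
  by move=> cB'; exact: (@leq_bigmax_seq _ B xpredT kk).
(* With this constant the levels [k <= L] are trivial, there being at most [b ^ k] words. *)
exists (b ^ L)%:R; first by rewrite ltr0n.
elim/ltn_ind => k IH.
have [kleL|Lk] := leqP k L.
  apply: (@le_trans _ _ (b ^ L)%:R); last by rewrite ler_peMr.
  by rewrite ler_nat (leq_trans (cnt_le _ _))// leq_exp2l.
have sub : {subset ws (b ^ k) Z <= flatten [seq
    [seq (b ^ (k - kk c) * i + j)%N |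
      i <- iota (Num.truncn ((b ^ kk c)%:R * c.1 - 1)) 3,
      j <- ws (b ^ (k - kk c)) Z] | c <- B]}.
  move=> w /wsP[z Zz <-]; have [c cB' zc] := cB _ Zz.
  have /andP[z0 z1] := Z1 _ Zz.
  have [c0 h1 h2 _] := kkP _ cB'.
  apply/flatten_mapP; exists c => //.
  have -> : (b ^ k = b ^ kk c * b ^ (k - kk c))%N.
    by rewrite -expnD subnKC// (leq_trans (kL _ cB'))// ltnW.
  rewrite dgM//; apply/allpairsP.
  exists (dg (b ^ kk c) z, dg (b ^ (k - kk c)) (fr ((b ^ kk c)%:R * z))).
  split => //; first exact: dg_near zc.
  by apply: ws_mem => //; apply: stableX.
have := uniq_leq_size (ws_uniq _ _) sub.
rewrite size_flatten sumnE /shape -map_comp big_map => hs.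
apply: (@le_trans _ _ (\sum_(c <- B) 3 * ((b ^ L)%:R *
    ((b ^ k)%:R `^ s * (b%:R `^ s * c.2 `^ s))))).
  rewrite -(ler_nat R) in hs; apply: (le_trans hs).
  rewrite natr_sum big_seq [leRHS]big_seq; apply: ler_sum => c cB'.
  rewrite /= size_cat size_cat size_cat !size_map -!/(cnt _ _) addn0.
  have [c0 h1 h2 k0] := kkP _ cB'.
  have := IH (k - kk c)%N; rewrite ltn_subrL k0 (leq_ltn_trans _ Lk)// => /(_ isT) IHk.
  have Ik : (cnt (b ^ (k - kk c)) Z)%:R <= (b ^ L)%:R *
    ((b ^ k)%:R `^ s * (b%:R `^ s * c.2 `^ s)) :> R.
    apply: (le_trans IHk); rewrite ler_pM2l ?ltr0n//.
    rewrite -powRM ?(ltW c0)// -powRM ?mulr_ge0 ?(ltW c0)//.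
    apply: ge0_ler_powR; rewrite ?nnegrE ?mulr_ge0 ?(ltW c0) ?(ltW s0)//.
    have {1}-> : (b ^ k = b ^ (k - kk c) * b ^ kk c)%N.
      by rewrite -expnD subnK// (leq_trans (kL _ cB'))// ltnW.
    rewrite natrM -mulrA ler_peMr// mulrA -natrM -expnSr; exact: ltW.
  rewrite !natrD; lra.
rewrite -mulr_sumr -mulr_sumr -mulr_sumr -mulr_sumr.
set S := \sum_(_ <- _) _ in sB *.
have h : 3 * (b%:R `^ s * S) <= 1.
  by rewrite mulrA mulrC -ler_pdivlMr ?mulr_gt0// div1r.
rewrite mulrCA ler_pM2l ?ltr0n// mulrCA.
by rewrite ler_piMr ?powR_ge0.
Qed.

(* The maps [times_map k] take values in [0, 1[, so that dropping the point 1 from an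
   invariant set leaves it invariant. *)
Definition core A : set R := A `&` [set x | 0 <= x < 1].

Lemma core_unit A : unit_set (core A).
Proof. by move=> x []. Qed.

(** The point 1, dropped in [core A], is put back. *)
Definition centers N A : seq R := 1 :: [seq w%:R / N%:R | w <- ws N (core A)].

Lemma centersP N A x : (0 < N)%N -> A `<=` [set` `[0, 1]] -> A x ->
  exists2 c, c \in centers N A & `|x - c| <= N%:R^-1.
Proof.
move=> N0 A1 Ax; have := A1 _ Ax; rewrite /= in_itv /= => /andP[x0].
rewrite le_eqVlt => /orP[/eqP ->|x1].
  by exists 1; rewrite ?inE ?eqxx// subrr normr0 invr_ge0.
have Nx : 0 < N%:R :> R by rewrite ltr0n.
exists ((dg N x)%:R / N%:R).
  rewrite inE; apply/orP; right.
  apply: (map_f (fun w : nat => w%:R / N%:R : R)).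
  by apply: ws_mem => //; [exact: core_unit|split => //; apply/andP].
exact: dg_approx.
Qed.

Lemma size_centers N A : size (centers N A) = (cnt N (core A)).+1.
Proof. by rewrite /= size_map. Qed.

(** If one level [N = b ^ k] had only [N ^ s1] words with [s1 < s], submultiplicativity would give
    at most [N ^ (j s1)] words at every level [N ^ j], and their cylinders would form covers of
    small [s]-weight. *)
Lemma cnt_lower (b : nat) A s : (1 < b)%N -> A `<=` [set` `[0, 1]] ->
  stable b (core A) -> core A !=set0 -> 0 < s -> ~ small_cover s A ->
  forall k, (b ^ k)%:R `^ s <= (cnt (b ^ k) (core A))%:R :> R.
Proof.
move=> b1 A1 Ab A0 s0 nA k; rewrite leNgt; apply/negP => ck; apply: nA.
have k0 : (0 < k)%N.
  case: k ck => //; rewrite expn0 powR1 (ltr_nat R _ 1) ltnNge.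
  by rewrite cnt_gt0//; exact: core_unit.
have N1 : (1 < b ^ k)%N by rewrite -{1}(exp1n k) ltn_exp2r.
have Nb : stable (b ^ k) (core A) by apply: stableX => //; exact: core_unit.
move: ck N1 Nb; set N := (b ^ k)%N => ck N1 Nb.
have N0 : (0 < N)%N by exact: ltnW.
set c := cnt N _ in ck.
have c0 : (0 < c)%N by apply: cnt_gt0 => //; exact: core_unit.
have lN : 0 < ln (N%:R : R) by rewrite ln_gt0// ltr1n.
pose s1 : R := ln c%:R / ln N%:R.
have NE (u : R) : N%:R `^ u = expR (u * ln N%:R) by rewrite /powR pnatr_eq0 gtn_eqF.
have cE : N%:R `^ s1 = c%:R.
  by rewrite NE /s1 divfK ?gt_eqF// lnK// posrE ltr0n.
have s10 : 0 <= s1 by rewrite divr_ge0 ?ln_ge0 ?ler1n// ltW.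
have s1s : s1 < s.
  by move: ck; rewrite -cE !NE ltr_expR ltr_pM2r.
(* The constant 2 absorbs the additional centre 1: [c ^ j + 1 <= 2 c ^ j]. *)
apply: (@small_cover_centers _ _ s1 2) => // r0 r00.
pose j := (Num.truncn r0^-1).+1.
have Nj0 : 0 < (N ^ j)%:R :> R by rewrite ltr0n expn_gt0 N0.
exists ((N ^ j)%:R^-1); split; first by rewrite invr_gt0.
  rewrite -[leRHS]invrK lef_pV2 ?posrE ?invr_gt0//.
  rewrite (le_trans (ltW (truncnS_gt _)))// ler_nat ltnW//.
  by rewrite ltn_expl.
exists (centers (N ^ j) A); split.
  by move=> x; apply: centersP => //; rewrite expn_gt0 N0.
rewrite size_centers.
have -> : (N ^ j)%:R^-1 `^ s1 = (c%:R ^+ j)^-1 :> R.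
  have -> : c%:R ^+ j = (N ^ j)%:R `^ s1 :> R.
    by rewrite natrX -[N%:R ^+ j]powR_mulrn// powRAC cE powR_mulrn.
  by rewrite -powR_inv1 ?(ltW Nj0)// powRAC powR_inv1// powR_ge0.
rewrite ler_pdivrMr ?exprn_gt0 ?ltr0n// -natrX -natrM ler_nat.
have := @cntX _ N j _ N0 (@core_unit A) Nb; rewrite -/c => h.
have : (0 < c ^ j)%N by rewrite expn_gt0 c0.
lia.
Qed.

End BoxCounting.

(** * The upper bound for the sumset *)

Section SumsetUpper.
Variable R : realType.
Implicit Types (X Y : set R).

Lemma exists_inv_expn (b : nat) (r : R) : (1 < b)%N -> 0 < r ->
  exists k, (b ^ k)%:R^-1 <= r.
Proof.
move=> b1 r0; have b0 : (0 < b)%N by exact: ltnW.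
have [k rk] : exists k : nat, r^-1 <= k%:R.
  by exists (Num.truncn r^-1).+1; exact/ltW/truncnS_gt.
exists k; rewrite -[leRHS]invrK lef_pV2 ?posrE ?invr_gt0// ?ltr0n ?expn_gt0 ?b0//.
by rewrite (le_trans rk)// ler_nat ltnW// ltn_expl.
Qed.

(** Covers of [X] at scale [m^-k] and of [Y] at scale [n^-l], where [n ^ l <= m ^ k < n ^ l.+1], are
    added; the numbers of centres multiply. *)
Lemma small_cover_sumset (m n : nat) X Y (t s1 s2 s C1 C2 : R) :
  (1 < m)%N -> (1 < n)%N ->
  X `<=` [set` `[0, 1]] -> Y `<=` [set` `[0, 1]] -> 0 < s1 -> 0 < s2 ->
  0 < C1 -> 0 < C2 ->
  (forall k, (cnt (m ^ k) (core X))%:R <= C1 * (m ^ k)%:R `^ s1) ->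
  (forall k, (cnt (n ^ k) (core Y))%:R <= C2 * (n ^ k)%:R `^ s2) ->
  s1 + s2 < s -> small_cover s [set x + t * y | x in X & y in Y].
Proof.
move=> m1 n1 X1 Y1 s10 s20 C10 C20 cX cY ss.
(* As [n^-l < n m^-k], the error [m^-k + |t| n^-l] is at most [K m^-k]. *)
pose K : R := 1 + `|t| * n%:R.
have K0 : 0 < K by rewrite ltr_wpDr// mulr_ge0.
apply: (@small_cover_centers _ _ (s1 + s2)
  ((C1 + 1) * (C2 + 1) * K `^ (s1 + s2))) => //.
- by rewrite addr_ge0// ltW.
- by rewrite !mulr_gt0 ?powR_gt0// addr_gt0.
move=> r0 r00.
have [k kr] := exists_inv_expn m1 (divr_gt0 r00 K0).
have mk0 : (0 < m ^ k)%N by rewrite expn_gt0 (ltnW m1).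
have mk1 : 1 <= (m ^ k)%:R :> R by rewrite ler1n.
move: kr mk0 mk1 (cX k); set Mk := (m ^ k)%N => kr mk0 mk1 cXk.
have Mk0 : 0 < Mk%:R :> R by rewrite ltr0n.
have iM0 : 0 < Mk%:R^-1 :> R by rewrite invr_gt0.
have iM1 : Mk%:R^-1 <= 1 :> R by rewrite invf_le1.
have [h1 h2] := logrP n1 iM0 iM1.
move: h1 h2; set l := logr n _.
rewrite ler_pdivrMr// mul1r ltr_pdivlMr// mul1r expnS natrM => h1 h2.
have nl0 : (0 < n ^ l)%N by rewrite expn_gt0 (ltnW n1).
move: h1 h2 nl0 (cY l); set Nl := (n ^ l)%N => h1 h2 nl0 cYl.
have Nl0 : 0 < Nl%:R :> R by rewrite ltr0n.
have Nl1 : 1 <= Nl%:R :> R by rewrite ler1n.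
have n0 : 0 < n%:R :> R by rewrite ltr0n (ltnW n1).
exists (K * Mk%:R^-1); split; first by rewrite mulr_gt0.
  by rewrite mulrC -ler_pdivlMr.
exists [seq a + t * b | a <- centers Mk X, b <- centers Nl Y]; split.
  move=> _ [x Xx [y Yy <-]].
  have [a aX xa] := centersP mk0 X1 Xx.
  have [b bY yb] := centersP nl0 Y1 Yy.
  exists (a + t * b); first by apply/allpairsP; exists (a, b).
  have -> : x + t * y - (a + t * b) = (x - a) + t * (y - b) by ring.
  rewrite (le_trans (ler_normD _ _))// normrM mulrDl mul1r lerD// -mulrA.
  rewrite ler_wpM2l// (le_trans yb)// -div1r ler_pdivrMr// mulrAC.
  by rewrite ler_pdivlMr// mul1r ltW.
rewrite size_allpairs !size_centers.
have ex (q : R) : 0 < q -> 1 <= Mk%:R `^ q.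
  by move=> q0; rewrite -[leLHS](powRr0 Mk%:R) ler_powR// ltW.
have a1 : (cnt Mk (core X)).+1%:R <= (C1 + 1) * Mk%:R `^ s1.
  by rewrite -natr1 mulrDl mul1r lerD// ex.
have a2 : (cnt Nl (core Y)).+1%:R <= (C2 + 1) * Mk%:R `^ s2.
  rewrite -natr1 mulrDl mul1r lerD// ?ex//.
  rewrite (le_trans cYl)// ler_pM2l//.
  by apply: ge0_ler_powR; rewrite ?nnegrE// ltW.
rewrite natrM.
have := ler_pM (ler0n _ _) (ler0n _ _) a1 a2.
rewrite powRM ?(ltW K0) ?(ltW iM0)//.
have -> : Mk%:R^-1 `^ (s1 + s2) = (Mk%:R `^ s1 * Mk%:R `^ s2)^-1.
  rewrite -powRD; last by apply/implyP => _; rewrite gt_eqF.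
  by rewrite -powR_inv1 ?(ltW Mk0)// powRAC powR_inv1// powR_ge0.
have p1 : 0 < Mk%:R `^ s1 by rewrite powR_gt0.
have p2 : 0 < Mk%:R `^ s2 by rewrite powR_gt0.
move=> h; rewrite mulrA ler_pdivrMr ?mulr_gt0//.
have p3 : 0 < K `^ (s1 + s2) by rewrite powR_gt0.
rewrite -[leRHS]mulrA [_ `^ (_ + _) * (_ * _)]mulrC mulrA ler_pM2r//.
by rewrite (le_trans h)// le_eqVlt; apply/orP; left; apply/eqP; ring.
Qed.

End SumsetUpper.

(** * Multiplicative independence and rotations *)

(** A Euclidean descent: if [m < n], then [m ^ j] divides [n ^ j], so [n = q m] and
    [m ^ (i - j) = q ^ j], with a smaller sum [m + q]. *)
Lemma expn_eq_common_base (m n i j : nat) : (0 < m)%N -> (0 < n)%N ->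
  (0 < i)%N -> (0 < j)%N -> (m ^ i = n ^ j)%N ->
  exists c a b, (m = c ^ a /\ n = c ^ b)%N.
Proof.
have [k] := ubnP (m + n)%N; elim: k m n i j => // k IH m n i j.
rewrite ltnS => mnk m0 n0 i0 j0 e.
wlog mn : m n i j mnk m0 n0 i0 j0 e / (m <= n)%N.
  move=> H; have [|nm] := leqP m n; first exact: H e.
  have [|c [a [b [-> ->]]]] := H n m j i _ n0 m0 j0 i0 (esym e) (ltnW nm).
    by rewrite addnC.
  by exists c, b, a.
have [m1|m1] := leqP m 1.
  have me : m = 1%N by apply/eqP; rewrite eqn_leq m1.
  have ne : n = 1%N.
    move: e; rewrite me exp1n => /esym/eqP.
    by rewrite -[X in _ == X](exp1n j) eqn_exp2r// => /eqP.
  by exists 1%N, 1%N, 1%N; rewrite me ne.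
have [mnE|mnE] := eqVneq m n; first by exists m, 1%N, 1%N; rewrite -mnE.
have ltmn : (m < n)%N by rewrite ltn_neqAle mnE.
have ji : (j < i)%N.
  rewrite ltnNge; apply/negP => ij.
  have : (m ^ i < n ^ j)%N.
    rewrite (@leq_trans (n ^ i))// ?ltn_exp2r// leq_exp2l//.
    exact: ltn_trans ltmn.
  by rewrite e ltnn.
have : (m ^ j %| n ^ j)%N by rewrite -e dvdn_exp2l// ltnW.
rewrite dvdn_pexp2r// => /dvdnP[q nq].
have q0 : (0 < q)%N by rewrite lt0n; apply/eqP => q0; move: n0; rewrite nq q0.
have e' : (m ^ (i - j) = q ^ j)%N.
  apply/eqP; rewrite -(eqn_pmul2r (_ : 0 < m ^ j)%N) ?expn_gt0 ?m0//.
  by rewrite -expnD subnK ?(ltnW ji)// e nq expnMn.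
have [||c [a [b [em eq]]]] := IH m q (i - j)%N j _ m0 q0 _ j0 e'.
- apply: leq_trans mnk; rewrite ltn_add2l nq.
  by rewrite -{1}[q]muln1 ltn_pmul2l.
- by rewrite subn_gt0.
by exists c, a, (b + a)%N; split => //; rewrite nq expnD -em -eq.
Qed.

Lemma powers_of_same_integerP (m n i j : nat) : (0 < m)%N -> (0 < n)%N ->
  (0 < i)%N -> (0 < j)%N -> (m ^ i = n ^ j)%N -> powers_of_same_integer m n.
Proof.
move=> m0 n0 i0 j0 /(expn_eq_common_base m0 n0 i0 j0)[c [a [b [-> ->]]]].
by exists c%:Z, a, b; rewrite -!natz !natrX.
Qed.

Section Rotation.
Variable R : realType.
Implicit Types (lam th eta : R).

Definition nonresonant lam := forall (k : nat) (z : int), (0 < k)%N ->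
  k%:R * lam != z%:~R.

Lemma frE (x : R) : exists z : int, x = fr x + z%:~R.
Proof. by exists (Num.floor x); rewrite /fr subrK. Qed.

(** By the pigeonhole principle some [s * lam] differs from an integer by [e] with
    [|e| < 1 / N <= eta], and [e] is nonzero by nonresonance. Steps of size [e] cannot jump over an
    arc of length [eta], and the number of steps needed to reach it is bounded independently of
    [th]. *)
Lemma return_time lam eta : nonresonant lam -> 0 < eta ->
  exists G : nat, forall th, exists2 g : nat, (g < G)%N & fr (th + g%:R * lam) < eta.
Proof.
move=> irr eta0.
have [N N0 Neta] : exists2 N : nat, 0 < N%:R :> R & N%:R^-1 <= eta.
  exists (Num.truncn eta^-1).+1; first by rewrite ltr0n.
  rewrite -[leRHS]invrK lef_pV2 ?posrE ?invr_gt0// ?ltr0n//.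
  exact/ltW/truncnS_gt.
have binlt (j : 'I_N.+1) : (Num.truncn (N%:R * fr (j%:R * lam)) < N)%N.
  rewrite truncn_lt_nat ?mulr_ge0 ?fr_ge0//.
  by rewrite gtr_pMr// fr_lt1.
pose bin j := Ordinal (binlt j).
have : ~~ injectiveb bin.
  apply/negP => /injectiveP /leq_card; rewrite !card_ord.
  by rewrite ltnn.
case/injectivePn => j [j' jj' ebin].
wlog lt_jj' : j j' jj' ebin / (j < j')%N.
  move=> H; have [|h|h] := ltngtP j j'; first exact: H.
    by apply: (H j' j) => //; rewrite eq_sym.
  by move: jj'; rewrite (ord_inj h) eqxx.
pose s := (j' - j)%N; have s0 : (0 < s)%N by rewrite subn_gt0.
pose e := fr (j'%:R * lam) - fr (j%:R * lam).
have [z ze] : exists z : int, s%:R * lam = e + z%:~R.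
  have [z1 h1] := frE (j'%:R * lam); have [z2 h2] := frE (j%:R * lam).
  exists (z1 - z2); rewrite /s natrB ?(ltnW lt_jj')// mulrBl {1}h1 {1}h2.
  by rewrite intrD mulrNz /e; ring.
have e0 : e != 0.
  by apply/eqP => e0; have := irr _ z s0; rewrite ze e0 add0r eqxx.
have eN : `|e| < N%:R^-1.
  have := congr1 val ebin; rewrite /= => hb.
  have u0 : 0 <= N%:R * fr (j%:R * lam) by rewrite mulr_ge0 ?fr_ge0.
  have u1 : 0 <= N%:R * fr (j'%:R * lam) by rewrite mulr_ge0 ?fr_ge0.
  have := truncn_itv u0; have := truncn_itv u1; rewrite hb -!natr1.
  set w := (Num.truncn _)%:R => /andP[h1 h2] /andP[h3 h4].
  have h : `|N%:R * e| < 1.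
    by rewrite /e mulrBr ltr_norml; apply/andP; split; lra.
  by rewrite -[X in _ < X]mul1r ltr_pdivlMr// -[X in _ * X](gtr0_norm N0)
    -normrM [e * _]mulrC.
have frs th (r : nat) : fr (th + (s * r)%:R * lam) = fr (fr th + r%:R * e).
  have [z1 h1] := frE th.
  have -> : th + (s * r)%:R * lam = fr th + r%:R * e + (z1 + r%:Z * z)%:~R.
    rewrite {1}h1 natrM mulrAC ze intrD intrM; ring.
  by rewrite frDz.
exists (s * (Num.truncn `|e|^-1).+2).+1 => th.
have f0 := fr_ge0 th; have f1 := fr_lt1 th; set f := fr th in f0 f1 frs *.
have ae0 : 0 < `|e| by rewrite normr_gt0.
have trle (u : R) : 0 <= u -> u <= 1 ->
    (Num.truncn (u / `|e|) <= Num.truncn `|e|^-1)%N.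
  by move=> u0 u1; apply: le_truncn; rewrite ler_piMl// invr_ge0 ltW.
have [ep|en|e0'] := ltgtP 0 e; last by rewrite -e0' eqxx in e0.
  move: eN ae0 trle; rewrite gtr0_norm// => eN ae0 trle.
  (* The first step beyond 1 lands in []0, e]] modulo 1. *)
  pose r := (Num.truncn ((1 - f) / e)).+1.
  have u0 : 0 <= (1 - f) / e by rewrite divr_ge0 ?(ltW ep)//; lra.
  have := truncn_itv u0; rewrite ler_pdivlMr// ltr_pdivrMr// -/r => /andP[h1 h2].
  exists (s * r)%N.
    by rewrite ltnS leq_mul2l; apply/orP; right; rewrite ltnS leqW// trle//; lra.
  rewrite frs -/f.
  have -> : f + r%:R * e = 1%:R + (f + r%:R * e - 1) by lra.
  have rE : r%:R = (Num.truncn ((1 - f) / e))%:R + 1 :> R by rewrite natr1.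
  have N1 : N%:R^-1 <= 1 :> R by rewrite invf_le1// ler1n -(ltr0n R).
  rewrite frDn fr_id; move: h1 h2; rewrite rE; lra.
move: eN ae0 trle; rewrite ltr0_norm// => eN ae0 trle.
(* For negative [e], the last step that stays nonnegative lands in [[0, - e[]. *)
pose r := Num.truncn (f / - e).
have u0 : 0 <= f / - e by rewrite divr_ge0// ltW.
have := truncn_itv u0; rewrite ler_pdivlMr// ltr_pdivrMr// -/r -natr1 => /andP[h1 h2].
exists (s * r)%N.
  by rewrite ltnS leq_mul2l; apply/orP; right; rewrite leqW// leqW// trle//; lra.
have N1 : N%:R^-1 <= 1 :> R by rewrite invf_le1// ler1n -(ltr0n R).
by rewrite frs -/f fr_id; lra.
Qed.

(** A relation [k lam = z] exponentiates to [m ^ (k q) = n ^ z], with [z > 0] as both logarithms are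
    positive. *)
Lemma nonresonant_ln_ratio (m n q : nat) : (1 < m)%N -> (1 < n)%N -> (0 < q)%N ->
  ~ powers_of_same_integer m n -> nonresonant (ln (m ^ q)%:R / ln n%:R : R).
Proof.
move=> m1 n1 q0 hmn k z k0; apply/eqP => e; apply: hmn.
have lm : 0 < ln m%:R :> R by rewrite ln_gt0 ?ltr1n.
have ln0 : 0 < ln n%:R :> R by rewrite ln_gt0 ?ltr1n.
have mE : ln (m ^ q)%:R = q%:R * ln m%:R :> R.
  by rewrite natrX lnXn ?mulr_natl// ltr0n ltnW.
have e' : (k * q)%:R * ln m%:R = z%:~R * ln n%:R :> R.
  by rewrite -e mE natrM; field; rewrite gt_eqF.
have z0 : 0 < z%:~R :> R.
  by rewrite -(pmulr_lgt0 _ ln0) -e' mulr_gt0// ltr0n muln_gt0 k0.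
case: z e e' z0 => [z|z] e e' z0; last first.
  by move: z0; rewrite ltr0z.
rewrite -[(Posz z)%:~R]/(z%:R : R) in e' z0.
apply: (@powers_of_same_integerP _ _ (k * q) z).
- exact: ltnW.
- exact: ltnW.
- by rewrite muln_gt0 k0.
- by rewrite ltr0n in z0.
have : (m ^ (k * q))%:R = (n ^ z)%:R :> R.
  apply: ln_inj; rewrite ?posrE ?ltr0n ?expn_gt0 ?(ltnW m1) ?(ltnW n1)//.
  rewrite !natrX !lnXn ?ltr0n ?(ltnW m1) ?(ltnW n1)//.
  by rewrite -!(mulr_natl (ln _)).
by move/eqP; rewrite eqr_nat => /eqP.
Qed.

End Rotation.

(** * Coding paths by a cover of the sumset *)

(** Kraft's inequality branches on a key in this form. The nonnegativity of [F] makes repeated keys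
    in [S] harmless. *)
Lemma ler_sum_partition (R : realType) (T K : eqType) (E : seq T) (key : T -> K)
    (F : T -> R) (S : seq K) (W : K -> R) :
  (forall p, p \in E -> key p \in S) -> (forall p, 0 <= F p) ->
  (forall k, \sum_(p <- E | key p == k) F p <= W k) ->
  \sum_(p <- E) F p <= \sum_(k <- S) W k.
Proof.
move=> ES F0 FW.
apply: (@le_trans _ _ (\sum_(p <- E) \sum_(k <- S | key p == k) F p)).
  rewrite big_seq [leRHS]big_seq; apply: ler_sum => p pE.
  rewrite (big_rem (key p)) ?ES//= eqxx lerDl.
  by apply: sumr_ge0.
rewrite (eq_bigr (fun p => \sum_(k <- S) if key p == k then F p else 0)); last first.
  by move=> p _; rewrite big_mkcond.
rewrite exchange_big /=; apply: ler_sum => k _.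
by rewrite -big_mkcond.
Qed.

Section Coding.
Variable R : realType.
Variables (M n l : nat) (X Y : set R) (t : R).
Hypotheses (M1 : (1 < M)%N) (n1 : (1 < n)%N).
Hypotheses (X1 : unit_set X) (Y1 : unit_set Y).
Hypotheses (XM : stable M X) (Yn : stable n Y).
Variable lam : R.
Hypotheses (lamE : lam * ln n%:R = ln M%:R) (lam_l : lam < l%:R).
Implicit Types (th : R) (p : R * R).

Let M0 : (0 < M)%N. Proof. exact: ltnW. Qed.
Let n0 : (0 < n)%N. Proof. exact: ltnW. Qed.
Let MR : 0 < M%:R :> R. Proof. by rewrite ltr0n. Qed.
Let nR : 0 < n%:R :> R. Proof. by rewrite ltr0n. Qed.
Let lnn : 0 < ln n%:R :> R. Proof. by rewrite ln_gt0 ?ltr1n. Qed.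
Let lnM : 0 < ln M%:R :> R. Proof. by rewrite ln_gt0 ?ltr1n. Qed.
Let lam0 : 0 < lam. Proof. by rewrite -(pmulr_lgt0 _ lnn) lamE. Qed.
Let MX0 k : (0 < M ^ k)%N. Proof. by rewrite expn_gt0 M0. Qed.
Let nX0 k : (0 < n ^ k)%N. Proof. by rewrite expn_gt0 n0. Qed.

(* Block [a] of a path [p] consists of digit [a] of [p.1] in base [M] and of the [l]
   digits of [p.2] in base [n] from digit [ypos th a] on.  As [M = n `^ lam], the
   ratio of the two scales is [n `^ phase th a], up to the initial phase [th]. *)
Definition phase th (a : nat) : R := fr (a%:R * lam + th).
Definition ypos th (a : nat) : nat := Num.truncn (a%:R * lam + th).
Definition xtail (a : nat) p : R := fr ((M ^ a)%:R * p.1).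
Definition ytail th (a : nat) p : R := fr ((n ^ ypos th a)%:R * p.2).
Definition angle (u : R) : R := t * n%:R `^ u.

Definition words := [seq (w, v) | w <- ws M X, v <- ws (n ^ l) Y].
(* [2 / M] from the ball of the cover, [1 / M] and [|t| n / M] from truncating [x] and
   [y], and [1 / M] from the phase at which the stage started. *)
Definition kap : R := 4 + `|t| * n%:R.
Definition near (tau x y : R) (c : nat * nat) : bool :=
  `|(x - c.1%:R / M%:R) + tau * (y - c.2%:R / (n ^ l)%:R)| <= kap / M%:R.
Definition mult (tau x y : R) : nat := count (near tau x y) words.

Variable m1 : nat.
Definition bad th (a : nat) p : bool :=
  (m1 < mult (angle (phase th a)) (xtail a p) (ytail th a p))%N.

Lemma natr_powR (k : nat) (u : R) : (0 < k)%N -> k%:R `^ u = expR (u * ln k%:R).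
Proof. by move=> k0; rewrite /powR pnatr_eq0 gtn_eqF. Qed.

Lemma yposE th a : 0 <= th -> a%:R * lam + th = (ypos th a)%:R + phase th a.
Proof.
move=> th0; have u0 : 0 <= a%:R * lam + th by rewrite addr_ge0// mulr_ge0// ltW.
rewrite /ypos /phase /fr truncn_floor u0.
have : 0 <= Num.floor (a%:R * lam + th) by rewrite floor_ge0.
case: (Num.floor _) => // k _; rewrite absz_nat.
by rewrite [RHS]addrC -[(Posz k)%:~R]/(k%:R : R) subrK.
Qed.

Lemma ypos_le th a b : 0 <= th -> (a <= b)%N -> (ypos th a <= ypos th b)%N.
Proof.
move=> th0 ab; apply: le_truncn; rewrite lerD2r ler_pM2r//.
by rewrite ler_nat.
Qed.

Lemma ypos_step th a : 0 <= th -> (ypos th a.+1 <= ypos th a + l)%N.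
Proof.
move=> th0; have := yposE a th0; have := yposE a.+1 th0.
have := fr_lt1 (a%:R * lam + th); have := fr_ge0 (a.+1%:R * lam + th).
rewrite -/(phase th a) -/(phase th a.+1) => h1 h2; rewrite -natr1 mulrDl mul1r => h3 h4.
rewrite -ltnS -(ltr_nat R) -natr1 natrD; move: lam_l; lra.
Qed.

Lemma MX_powR k : (M ^ k)%:R = n%:R `^ (k%:R * lam) :> R.
Proof.
rewrite natr_powR// -mulrA lamE.
by rewrite natrX expRM_natl lnK// posrE.
Qed.

Lemma M_lt_nl : M%:R <= (n ^ l)%:R :> R.
Proof.
rewrite -[M]expn1 MX_powR mul1r natrX -powR_mulrn//.
by apply: ler_powR; rewrite ?ler1n// ltW.
Qed.

Lemma dg_coarse N N' (x y : R) : (0 < N')%N -> 0 <= x -> 0 <= y ->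
  dg (N * N') x = dg (N * N') y -> dg N x = dg N y.
Proof.
move=> N'0 x0 y0; rewrite !dgM// => e.
have H (z : R) : (dg N' (fr (N%:R * z)) %/ N' = 0)%N.
  by apply: divn_small; apply: dg_lt; rewrite ?fr_ge0 ?fr_lt1.
have := congr1 (fun k => k %/ N')%N e.
by rewrite !(mulnC N') !divnMDl// !H !addn0.
Qed.

Lemma dg_fr N N' (x y : R) : 0 <= x -> 0 <= y -> dg N x = dg N y ->
  dg (N * N') x = dg (N * N') y -> dg N' (fr (N%:R * x)) = dg N' (fr (N%:R * y)).
Proof. by move=> x0 y0 e; rewrite !dgM// e => /addnI. Qed.

Lemma mul_fr_sub N (x y : R) : 0 <= x -> 0 <= y -> dg N x = dg N y ->
  N%:R * (x - y) = fr (N%:R * x) - fr (N%:R * y).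
Proof.
by move=> x0 y0 e; have := dgE N x0; have := dgE N y0; rewrite mulrBr e; lra.
Qed.

Definition same_prefix th a p p' :=
  dg (M ^ a) p.1 = dg (M ^ a) p'.1 /\
  dg (n ^ ypos th a) p.2 = dg (n ^ ypos th a) p'.2.

Definition in_sets p := X p.1 /\ Y p.2.

(** Removing common digits multiplies the differences of the tails by exactly [M ^ j] and [n ^ d].
    The quotient [M ^ j / n ^ d] is [n] to the power of the phase difference, which gives the new
    slope. *)
Lemma zoom_diff th a0 a p p' : 0 <= th -> (a0 <= a)%N -> in_sets p -> in_sets p' ->
  same_prefix th a p p' ->
  (M ^ (a - a0))%:R * ((xtail a0 p + t * ytail th a0 p)
     - (xtail a0 p' + t * ytail th a0 p')) =
  (xtail a p - xtail a p') +
    angle (phase th a - phase th a0) * (ytail th a p - ytail th a p').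
Proof.
move=> th0 aa [Xp Yp] [Xp' Yp'] [ex ey].
have /andP[x0 x1] := X1 Xp; have /andP[y0 y1] := Y1 Yp.
have /andP[x0' x1'] := X1 Xp'; have /andP[y0' y1'] := Y1 Yp'.
set j := (a - a0)%N; have aE : a = (a0 + j)%N by rewrite subnKC.
have yy := ypos_le th0 aa.
set d := (ypos th a - ypos th a0)%N.
have yE : ypos th a = (ypos th a0 + d)%N by rewrite subnKC.
have ex' : dg (M ^ a0 * M ^ j) p.1 = dg (M ^ a0 * M ^ j) p'.1.
  by rewrite -expnD -aE.
have ey' : dg (n ^ ypos th a0 * n ^ d) p.2 = dg (n ^ ypos th a0 * n ^ d) p'.2.
  by rewrite -expnD -yE.
have ex0 := dg_coarse (MX0 _) x0 x0' ex'.
have ey0 := dg_coarse (nX0 _) y0 y0' ey'.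
have hx : (M ^ j)%:R * (xtail a0 p - xtail a0 p') = xtail a p - xtail a p'.
  rewrite mul_fr_sub ?fr_ge0//; last exact: dg_fr.
  by rewrite /xtail !frM// -expnD -aE.
have hy : (n ^ d)%:R * (ytail th a0 p - ytail th a0 p') = ytail th a p - ytail th a p'.
  rewrite mul_fr_sub ?fr_ge0//; last exact: dg_fr.
  by rewrite /ytail !frM// -expnD -yE.
have -> : angle (phase th a - phase th a0) = t * ((M ^ j)%:R / (n ^ d)%:R).
  have h1 := yposE a th0; have h2 := yposE a0 th0.
  have -> : phase th a - phase th a0 = j%:R * lam - d%:R.
    rewrite /j /d !natrB//; lra.
  rewrite MX_powR natrX -powR_mulrn// /angle powRB//.
  by apply/implyP => _; rewrite gt_eqF.
rewrite -hx -hy.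
have : (n ^ d)%:R != 0 :> R by rewrite pnatr_eq0 -lt0n.
move=> nd0; field; exact: nd0.
Qed.

Definition digits th a p : nat * nat :=
  (dg M (xtail a p), dg (n ^ l) (ytail th a p)).

Lemma digits_words th a p : in_sets p -> digits th a p \in words.
Proof.
move=> [Xp Yp]; apply/allpairsP; exists (digits th a p); split => //.
  by apply: ws_mem => //; apply: stableX.
by apply: ws_mem => //; apply: stableX.
Qed.

(** The [l] digits of [y] read in a block reach at least to the start of the next one, by
    [ypos_step]: blocks may overlap but leave no gap. *)
Lemma same_prefixS th a p p' : 0 <= th -> in_sets p -> in_sets p' ->
  same_prefix th a p p' -> digits th a p = digits th a p' ->
  same_prefix th a.+1 p p'.
Proof.
move=> th0 [Xp Yp] [Xp' Yp'] [ex ey] [dx dy].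
have /andP[x0 x1] := X1 Xp; have /andP[y0 y1] := Y1 Yp.
have /andP[x0' x1'] := X1 Xp'; have /andP[y0' y1'] := Y1 Yp'.
split; first by rewrite expnSr !dgM// ex dx.
have h1 := ypos_step a th0; have h2 := ypos_le th0 (leqnSn a).
apply: (@dg_coarse _ (n ^ (ypos th a + l - ypos th a.+1)) _ _ (nX0 _)) => //.
by rewrite -expnD subnKC// expnD !dgM// ey dy.
Qed.

Definition zpt th a p : R := xtail a p + t * ytail th a p.

Variable eta : R.
Hypothesis etaP : `|t| * n%:R * (ln n%:R * eta) <= M%:R^-1.

(** Zooming from block [a0] yields the slope at the phase difference, whereas [bad] refers to the
    phase itself; a starting phase below [eta] makes the discrepancy at most [1 / M]. *)
Lemma angle_sub (u v : R) : 0 <= v -> v < eta -> u < 1 ->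
  `|angle (u - v) - angle u| <= M%:R^-1.
Proof.
move=> v0 ve u1.
have -> : angle (u - v) - angle u = t * n%:R `^ u * (expR (- (v * ln n%:R)) - 1).
  rewrite /angle powRD; last by apply/implyP => _; rewrite gt_eqF.
  by rewrite [_ `^ (- v)]natr_powR// mulNr; ring.
rewrite !normrM; have h1 : `|n%:R `^ u| <= n%:R :> R.
  rewrite ger0_norm ?powR_ge0// -[leRHS](powRr1 (ltW nR)).
  by apply: ler_powR; rewrite ?ler1n// ltW.
have h2 : `|expR (- (v * ln n%:R)) - 1| <= ln n%:R * eta.
  have := expR_ge1Dx (- (v * ln n%:R)).
  have : expR (- (v * ln n%:R)) <= 1 by rewrite expR_le1 oppr_le0 mulr_ge0// ltW.
  have : v * ln n%:R <= ln n%:R * eta by rewrite mulrC ler_pM2l// ltW.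
  by move=> a1 a2 a3; rewrite ler_norml; apply/andP; split; lra.
apply: le_trans etaP; rewrite -!mulrA ler_wpM2l//.
by apply: ler_pM.
Qed.

(** Points in one ball at the start of a stage still project to within [2 / M] of each other at
    block [a], as long as the radius is at most [M^-(a - a0 + 1)]. Hence the next digits of all of
    them lie in the strip around any one of them. *)
Lemma near_good th a0 a p p' (c : R * R) : 0 <= th -> (a0 <= a)%N ->
  in_sets p -> in_sets p' -> same_prefix th a p p' -> phase th a0 < eta ->
  `|zpt th a0 p - c.1| <= c.2 -> `|zpt th a0 p' - c.1| <= c.2 ->
  (M ^ (a - a0).+1)%:R * c.2 <= 1 ->
  near (angle (phase th a)) (xtail a p) (ytail th a p) (digits th a p').
Proof.
move=> th0 aa sp sp' pp ph0 zp zp' Mc; rewrite /near /=.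
have := zoom_diff th0 aa sp sp' pp; set tau := angle (_ - _) => hz.
have taud : `|tau - angle (phase th a)| <= M%:R^-1.
  by apply: angle_sub; rewrite ?fr_ge0 ?fr_lt1.
set tau' := angle (phase th a) in taud *.
have iM : 0 < M%:R^-1 :> R by rewrite invr_gt0.
have atau : `|tau'| <= `|t| * n%:R.
  rewrite normrM ler_wpM2l// ger0_norm ?powR_ge0// -[leRHS](powRr1 (ltW nR)).
  by apply: ler_powR; rewrite ?ler1n// ltW// fr_lt1.
have dz : `|(xtail a p - xtail a p') + tau * (ytail th a p - ytail th a p')|
    <= 2 * M%:R^-1.
  rewrite -hz normrM ger0_norm//.
  have : `|zpt th a0 p - zpt th a0 p'| <= 2 * c.2.
    rewrite (le_trans (ler_distD c.1 _ _))// mulr_natl mulr2n lerD//.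
    by rewrite distrC.
  move=> h.
  rewrite ler_pdivlMr//; move: Mc; rewrite expnS natrM => Mc.
  apply: (@le_trans _ _ ((M ^ (a - a0))%:R * (2 * c.2) * M%:R)); last by lra.
  by rewrite ler_pM2r// ler_wpM2l.
have ex : `|xtail a p' - (dg M (xtail a p'))%:R / M%:R| <= M%:R^-1.
  by apply: dg_approx; rewrite ?fr_ge0.
have ey : `|ytail th a p' - (dg (n ^ l) (ytail th a p'))%:R / (n ^ l)%:R| <= M%:R^-1.
  apply: le_trans (dg_approx _ _) _ => //; first exact: fr_ge0.
  by rewrite lef_pV2 ?posrE ?ltr0n ?nX0// M_lt_nl.
have dy : `|ytail th a p - ytail th a p'| <= 1.
  have := fr_ge0 ((n ^ ypos th a)%:R * p.2); have := fr_lt1 ((n ^ ypos th a)%:R * p.2).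
  have := fr_ge0 ((n ^ ypos th a)%:R * p'.2); have := fr_lt1 ((n ^ ypos th a)%:R * p'.2).
  by rewrite /ytail ler_norml => *; apply/andP; split; lra.
move: dz ex ey dy taud; set x := xtail a p; set x' := xtail a p'.
set y := ytail th a p; set y' := ytail th a p'.
set w := (dg M x')%:R / M%:R; set v := (dg _ y')%:R / (n ^ l)%:R => dz ex ey dy taud.
have -> : x - w + tau' * (y - v) = ((x - x') + tau * (y - y')) + (x' - w)
   + tau' * (y' - v) + (tau' - tau) * (y - y') by ring.
have h1 : `|tau' * (y' - v)| <= `|t| * n%:R * M%:R^-1 by rewrite normrM ler_pM.
have h2 : `|(tau' - tau) * (y - y')| <= M%:R^-1.
  by rewrite normrM -[leRHS]mulr1 ler_pM// distrC.
rewrite (le_trans (ler_normD _ _))// (le_trans (lerD (ler_normD _ _) h2))//.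
rewrite (le_trans (lerD (lerD (ler_normD _ _) h1) (lexx _)))//.
rewrite /kap mulrDl; lra.
Qed.

Variables cg cb : R.
Hypotheses (cgP : m1%:R * expR (- cg) <= 2^-1)
  (cbP : (size words)%:R * expR (- cb) <= 2^-1).

(* Blocks flagged by [fl] are charged [cb], which pays for all words; the digits
   of an unflagged block lie in the set counted by [mult], which [cg] pays for. *)
Lemma sum_block th a (E : seq (R * R)) (fl : pred (R * R)) (H : R * R -> R) :
  (forall p, p \in E -> in_sets p) ->
  (forall p p', p \in E -> p' \in E -> ~~ fl p -> ~~ fl p' ->
    near (angle (phase th a)) (xtail a p) (ytail th a p) (digits th a p')) ->
  (forall p, p \in E -> ~~ fl p ->
    (mult (angle (phase th a)) (xtail a p) (ytail th a p) <= m1)%N) ->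
  (forall p, 0 <= H p) ->
  (forall k, \sum_(p <- E | (fl p, digits th a p) == k) H p <= 1) ->
  \sum_(p <- E) expR (- (if fl p then cb else cg)) * H p <= 1.
Proof.
move=> sE nE mE H0 HE.
(* The strip of a single unflagged point contains the digits of all of them. *)
have [G GE Gs] : exists2 G : seq (nat * nat),
    forall p, p \in E -> ~~ fl p -> digits th a p \in G & (size G <= m1)%N.
  have [/allP aE|] := boolP (all fl E).
    by exists [::] => // p /aE ->.
  rewrite -has_predC => /hasP[p0 p0E /= fp0].
  exists [seq c <- words | near (angle (phase th a)) (xtail a p0) (ytail th a p0) c].
    by move=> p pE fp; rewrite mem_filter nE//=; exact/digits_words/sE.
  by rewrite size_filter; exact: mE.
(* The flagged keys weigh at most 1/2 together, and so do the others. *)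
pose W (k : bool * (nat * nat)) : R := expR (- (if k.1 then cb else cg)).
apply: (@le_trans _ _ (\sum_(k <- [seq (true, k) | k <- words] ++
    [seq (false, k) | k <- G]) W k)).
  apply: (@ler_sum_partition _ _ _ _ (fun p => (fl p, digits th a p))).
  - move=> p pE; rewrite mem_cat; apply/orP.
    have [fp|fp] := boolP (fl p); [left|right].
      by apply: (map_f (fun k => (true, k))); exact/digits_words/sE.
    by apply: (map_f (fun k => (false, k))); exact: GE.
  - by move=> p; rewrite mulr_ge0// expR_ge0.
  - move=> k; apply: (@le_trans _ _ (\sum_(p <- E | (fl p, digits th a p) == k) W k * H p)).
      by apply: ler_sum => p /eqP <-.
    by rewrite -mulr_sumr ler_piMr ?expR_ge0.
rewrite big_cat !big_map /= /W /= !big_const_seq !count_predT !iter_addr_0.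
rewrite -![expR _ *+ _]mulr_natl.
have : (size G)%:R * expR (- cg) <= m1%:R * expR (- cg).
  by rewrite ler_wpM2r ?expR_ge0// ler_nat.
move: cgP cbP; lra.
Qed.

Variables (s : R) (B : seq (R * R)).
Hypotheses (s0 : 0 < s) (Brad : forall b, b \in B -> 0 < b.2 <= M%:R^-1)
  (Bcov : covers B [set x + t * y | x in X & y in Y])
  (Bsum : \sum_(b <- B) b.2 `^ s <= 1).

Definition idx (z : R) : nat := find (fun c : R * R => `|z - c.1| <= c.2) B.
Definition rad (i : nat) : R := (nth (0, 0) B i).2.
Definition len (i : nat) : nat := logr M (rad i).
Definition blk th a p : R := if bad th a p then cb else cg.

(* A stage starts at a block whose phase is less than [eta], where the projection is
   almost the one along [t]: the code then names a ball of the cover, at the price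
   [- ln (rad ^ s)].  This ball has the scale of the next [len] blocks; [rem] of them
   are left, and [rem = 0] means waiting for the next stage. *)
Fixpoint cost th p (f a rem : nat) {struct f} : R :=
  match f with
  | 0 => 0
  | f'.+1 => match rem with
    | r.+1 => blk th a p + cost th p f' a.+1 r
    | 0 => if phase th a < eta then
             let i := idx (zpt th a p) in
             - (s * ln (rad i)) + (blk th a p + cost th p f' a.+1 (len i).-1)
           else cb + cost th p f' a.+1 0
    end
  end.

(** By invariance the tails of a point lie again in [X] and [Y], so the one cover of the sumset
    applies at every block. *)
Lemma zpt_cover th a p : in_sets p -> exists2 i, (i < size B)%N &
  idx (zpt th a p) = i /\ `|zpt th a p - (nth (0, 0) B i).1| <= rad i.
Proof.
move=> [Xp Yp]; have hB : has (fun c : R * R => `|zpt th a p - c.1| <= c.2) B.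
  have [|b bB hb] := Bcov (x := zpt th a p); last by apply/hasP; exists b.
  have Xa : X (xtail a p) by apply: stableX.
  by exists (xtail a p) => //; exists (ytail th a p) => //; apply: stableX.
exists (idx (zpt th a p)); first by rewrite -has_find.
by split => //; have := nth_find (0, 0) hB.
Qed.

Lemma rad_bound i : (i < size B)%N -> [/\ 0 < rad i, (0 < len i)%N,
  (M ^ len i)%:R * rad i <= 1 & 1 < (M ^ (len i).+1)%:R * rad i].
Proof.
move=> iB; have /andP[r0 rM] := Brad (mem_nth (0, 0) iB); rewrite -/(rad i) in r0 rM.
have r1 : rad i <= 1 by rewrite (le_trans rM)// invf_le1// ler1n.
have [h1 h2] := logrP M1 r0 r1; split => //.
rewrite lt0n; apply/eqP => l0; move: h2; rewrite -/(len i) l0 expn1 ltNge.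
by rewrite mulrC -ler_pdivlMr// div1r rM.
Qed.

(* Kraft's inequality. *)
Lemma sum_cost th f : 0 <= th -> forall a rem (E : seq (R * R)), uniq E ->
  (forall p, p \in E -> in_sets p) ->
  (forall p p', p \in E -> p' \in E -> same_prefix th a p p') ->
  ((0 < rem)%N -> exists a0 (c : R * R), [/\ (a0 <= a)%N, phase th a0 < eta,
     (M ^ (a - a0 + rem))%:R * c.2 <= 1 &
     forall p, p \in E -> `|zpt th a0 p - c.1| <= c.2]) ->
  (forall p p', p \in E -> p' \in E -> same_prefix th (a + f) p p' -> p = p') ->
  \sum_(p <- E) expR (- cost th p f a rem) <= 1.
Proof.
move=> th0; elim: f => [|f IH] a rem E uE sE pE rE fE /=.
  (* With no block left, all points share the prefix that separates them, so at most one remains. *)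
  case: E uE sE pE rE fE => [|p [|p' E]] uE sE pE rE fE; rewrite ?big_nil//.
    by rewrite big_seq1 oppr0 expR0.
  move: uE; rewrite /= inE negb_or.
  rewrite (fE p p') ?inE ?eqxx ?orbT// addn0.
  by apply: pE; rewrite !inE eqxx ?orbT.
(* Points with the same digits in block [a] share a prefix up to block [a + 1], so the induction
   hypothesis applies to them. *)
have sub (F : seq (R * R)) r fl k : {subset F <= E} -> uniq F ->
    ((0 < r)%N -> exists a0 (c : R * R), [/\ (a0 <= a.+1)%N, phase th a0 < eta,
     (M ^ (a.+1 - a0 + r))%:R * c.2 <= 1 &
     forall p, p \in F -> `|zpt th a0 p - c.1| <= c.2]) ->
    \sum_(p <- F | (fl p, digits th a p) == k :> bool * (nat * nat))
      expR (- cost th p f a.+1 r) <= 1.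
  move=> FE uF rF; rewrite -big_filter; apply: IH.
  - by rewrite filter_uniq.
  - by move=> p; rewrite mem_filter => /andP[_ /FE]; exact: sE.
  - move=> p p'; rewrite !mem_filter => /andP[/eqP e pF] /andP[/eqP e' p'F].
    have dd : digits th a p = digits th a p' := congr1 snd (etrans e (esym e')).
    by apply: same_prefixS => //; [exact/sE/FE|exact/sE/FE|apply: pE; exact: FE].
  - move=> /rF [a0 [c [h1 h2 h3 h4]]]; exists a0, c; split => // p.
    by rewrite mem_filter => /andP[_]; exact: h4.
  - move=> p p'; rewrite !mem_filter addSnnS => /andP[_ /FE pF] /andP[_ /FE p'F].
    exact: fE.
(* Inside a stage, the ball named at [a0] confines the digits, by [near_good]. *)
have stage (F : seq (R * R)) r : {subset F <= E} -> uniq F ->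
    (exists a0 (c : R * R), [/\ (a0 <= a)%N, phase th a0 < eta,
     (M ^ (a - a0 + r.+1))%:R * c.2 <= 1 &
     forall p, p \in F -> `|zpt th a0 p - c.1| <= c.2]) ->
    \sum_(p <- F) expR (- (blk th a p + cost th p f a.+1 r)) <= 1.
  move=> FE uF [a0 [c [h1 h2 h3 h4]]].
  rewrite (eq_bigr (fun p => expR (- (if bad th a p then cb else cg)) *
     expR (- cost th p f a.+1 r))); last by move=> p _; rewrite opprD expRD.
  apply: (sum_block (th := th) (a := a)).
  - by move=> p /FE; exact: sE.
  - move=> p p' pF p'F _ _; apply: (near_good (c := c) th0 h1) => //.
    + exact/sE/FE.
    + exact/sE/FE.
    + by apply: pE; exact: FE.
    + exact: h4.
    + exact: h4.
    apply: le_trans h3; rewrite ler_wpM2r ?(le_trans (normr_ge0 _) (h4 _ pF))//.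
    by rewrite ler_nat leq_exp2l// addnS ltnS leq_addr.
  - by move=> p _; rewrite -leqNgt.
  - by move=> p; exact: expR_ge0.
  - move=> k; apply: sub => // _; exists a0, c; split => //.
      exact: leqW.
    by rewrite subSn// addSnnS.
case: rem rE => [_|r /(_ isT) rE]; last exact: stage.
(* While waiting no ball is available: every point is flagged and [cb] pays for all words. *)
case pha: (phase th a < eta); last first.
  under eq_bigr => p _ do rewrite opprD expRD.
  have := @sum_block th a E predT (fun p => expR (- cost th p f a.+1 0)).
  apply.
  - exact: sE.
  - by move=> p p' _ _ /negP[].
  - by move=> p _ /negP[].
  - by move=> p; exact: expR_ge0.
  - by move=> k; apply: sub.
(* A new stage branches on the ball containing the projection; the code charges exactly its weight,
   and [Bsum] bounds the total. *)
apply: (@le_trans _ _ (\sum_(i <- iota 0 (size B)) rad i `^ s)); last first.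
  apply: le_trans Bsum; rewrite (big_nth (0, 0)) /index_iota subn0.
  by rewrite le_eqVlt eqxx.
apply: (@ler_sum_partition _ _ _ _ (fun p => idx (zpt th a p))).
- move=> p /sE /(zpt_cover th a)[i iB [-> _]]; by rewrite mem_iota.
- by move=> p; exact: expR_ge0.
move=> i; have [iB|iB] := ltnP i (size B); last first.
  rewrite big_seq_cond big1 ?powR_ge0// => p /andP[/sE /(zpt_cover th a)[j jB [-> _]]].
  by move/eqP => e; move: jB; rewrite e ltnNge iB.
have [r0 l0 h1 _] := rad_bound iB.
apply: (@le_trans _ _ (\sum_(p <- [seq p <- E | idx (zpt th a p) == i])
   rad i `^ s * expR (- (blk th a p + cost th p f a.+1 (len i).-1)))).
  rewrite big_filter; apply: ler_sum => p /eqP ->.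
  by rewrite opprD expRD opprK /powR gt_eqF.
rewrite -mulr_sumr ler_piMr ?powR_ge0//.
apply: stage; first by move=> p; rewrite mem_filter => /andP[].
  by rewrite filter_uniq.
exists a, (nth (0, 0) B i); split => //; first by rewrite subnn prednK.
move=> p; rewrite mem_filter => /andP[/eqP e /sE /(zpt_cover th a)[j jB [ej hj]]].
by move: hj; rewrite -ej e.
Qed.

Variables (G Jm : nat) (d0 : R).
Hypotheses (cg0 : 0 <= cg) (cb0 : 0 <= cb) (d00 : 0 <= d0)
  (return_time_lt : forall x, exists2 g : nat, (g < G)%N & fr (x + g%:R * lam) < eta)
  (lenm : forall i, (i < size B)%N -> (len i <= Jm)%N)
  (amortized : forall i, (i < size B)%N ->
     - (s * ln (rad i)) + G%:R * cb <= (len i)%:R * d0).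

Definition nbad th (a f : nat) p : nat := count (fun i => bad th i p) (iota a f).

(* A stage of length [J] costs at most [J * d0] together with the waiting time
   that follows it; [Jm * d0] pays for the stage that overshoots the end. *)
Lemma cost_le th p f a rem h : in_sets p -> (rem <= Jm)%N ->
  (if rem == 0%N then phase th (a + h) < eta else h == G) ->
  cost th p f a rem <= f%:R * cg + (nbad th a f p)%:R * cb
    + (f%:R - rem%:R) * d0 + Jm%:R * d0 + h%:R * cb.
Proof.
move=> sp; have cg0' := cg0; have cb0' := cb0; have d00' := d00.
(* [h] counts the blocks budgeted for waiting: those until a small phase if the code is waiting, and
   [G] in advance during a stage. *)
elim: f a rem h => [|f IH] a rem h remJ hh.
  rewrite /= /nbad /=.
  have : 0 <= h%:R * cb by rewrite mulr_ge0.
  have : rem%:R * d0 <= Jm%:R * d0 by rewrite ler_wpM2r// ler_nat.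
  lra.
have nbE : (nbad th a f.+1 p)%:R = (bad th a p)%:R + (nbad th a.+1 f p)%:R :> R.
  by rewrite /nbad /= natrD.
have blkE : blk th a p <= cg + (bad th a p)%:R * cb.
  by rewrite /blk; case: (bad th a p); rewrite /= ?mul1r ?mul0r; lra.
have step r : (r <= Jm)%N -> cost th p f a.+1 r <= f%:R * cg
    + (nbad th a.+1 f p)%:R * cb + (f%:R - r%:R) * d0 + Jm%:R * d0 + G%:R * cb.
  case: r => [|r] rJ; last by apply: IH => //=.
  have [g gG hg] := return_time_lt (a.+1%:R * lam + th).
  apply: le_trans (IH a.+1 0%N g _ _) _ => //=.
    rewrite /phase (_ : _ + th = a.+1%:R * lam + th + g%:R * lam)//.
    by rewrite natrD; lra.
  rewrite lerD2l ler_wpM2r// ler_nat; exact: ltnW.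
have b0 : 0 <= (bad th a p)%:R * cb by rewrite mulr_ge0.
rewrite /= nbE -natr1; case: rem remJ hh => [|r] remJ hh; last first.
  have /eqP -> : h == G := hh.
  have := step r (ltnW remJ); rewrite -natr1; lra.
have {}hh : phase th (a + h) < eta := hh.
case pha : (phase th a < eta).
  have [i iB [-> _]] := zpt_cover th a sp.
  have [_ l0 _ _] := rad_bound iB; have := amortized iB; have := lenm iB.
  move: l0; case: (len i) => // J _ JJ am /=.
  have := step J (ltnW JJ); move: am; rewrite -natr1.
  have : 0 <= h%:R * cb by rewrite mulr_ge0.
  lra.
case: h hh => [|h] hh; first by rewrite addn0 pha in hh.
have := IH a.+1 0%N h isT; rewrite addSnnS => /(_ hh).
rewrite -(natr1 h); lra.
Qed.

(** Every point of [E] costs at most the exponent on the right, so Kraft's inequality bounds their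
    number. *)
Lemma good_points_bound th K (E : seq (R * R)) (beta : R) : 0 <= th -> th < 1 -> uniq E ->
  (forall p, p \in E -> in_sets p) ->
  (forall p p', p \in E -> p' \in E -> same_prefix th K p p' -> p = p') ->
  (forall p, p \in E -> (nbad th 0 K p)%:R <= beta) ->
  (size E)%:R <= expR (K%:R * cg + beta * cb + K%:R * d0 + Jm%:R * d0 + G%:R * cb).
Proof.
move=> th0 th1 uE sE fE bE.
set D := _ + _ + _ + _ + _.
have cD p : p \in E -> cost th p K 0 0 <= D.
  move=> pE; have [g gG hg] := return_time_lt (0%:R * lam + th).
  apply: le_trans (@cost_le th p K 0%N 0%N g (sE _ pE) isT _) _.
    rewrite /= /phase (_ : _ + th = 0%:R * lam + th + g%:R * lam)//.
    by rewrite add0n; lra.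
  rewrite subr0 /D; have := ler_wpM2r cb0 (bE _ pE).
  have : g%:R * cb <= G%:R * cb by rewrite ler_wpM2r// ler_nat ltnW.
  lra.
have h : \sum_(p <- E) expR (- cost th p K 0 0) <= 1.
  apply: sum_cost => //.
  move=> p p' /sE[Xp Yp] /sE[Xp' Yp'].
  have /andP[x0 x1] := X1 Xp; have /andP[y0 y1] := Y1 Yp.
  have /andP[x0' x1'] := X1 Xp'; have /andP[y0' y1'] := Y1 Yp'.
  have dg1 (z : R) : z < 1 -> dg 1 z = 0%N.
    by move=> z1; apply/eqP; rewrite -leqn0 /dg mul1r truncn_le_nat.
  have y00 : ypos th 0 = 0%N.
    by apply/eqP; rewrite -leqn0 /ypos mul0r add0r truncn_le_nat.
  by split; rewrite ?y00 expn0 !dg1.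
suff : (size E)%:R * expR (- D) <= 1.
  by rewrite expRN ler_pdivrMr ?expR_gt0// mul1r.
apply: le_trans h.
rewrite mulr_natl -iter_addr_0 -(@count_predT _ E) -big_const_seq.
rewrite big_seq [leRHS]big_seq; apply: ler_sum => p pE.
by rewrite ler_expR lerN2 cD.
Qed.

End Coding.

(** * Exceptional phases *)

Section GridHits.
Variable R : realType.
Implicit Types (c u v : R) (S : pred R).

Lemma ln_ge_half (n : nat) : (1 < n)%N -> 2^-1 <= ln n%:R :> R.
Proof.
move=> n1; rewrite -ler_expR lnK ?posrE ?ltr0n ?(ltnW n1)//.
have : 2 <= n%:R :> R by rewrite ler_nat.
apply: le_trans.
have := expR_ge1Dx (- 2^-1 : R); rewrite expRN => h.
rewrite -[leRHS]invrK -[leLHS]invrK lef_pV2 ?posrE ?invr_gt0 ?expR_gt0//.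
by move: h; lra.
Qed.

(** For nonnegative arguments, [n ^ u] expands distances at least by the factor [ln n >= 1 / 2], so
    nearby angles come from nearby phases. *)
Lemma powR_sub_ge (n : nat) u v : (1 < n)%N -> 0 <= u -> 0 <= v ->
  `|u - v| <= 2 * `|n%:R `^ u - n%:R `^ v|.
Proof.
move=> n1; wlog uv : u v / v <= u.
  move=> H u0 v0; have [|/ltW] := leP v u; first by move/H; apply.
  by rewrite (distrC u) (distrC (n%:R `^ u)) => vu; apply: H.
move=> u0 v0; have l2 := ln_ge_half n1; have n0 : (0 < n)%N by apply: ltnW.
have -> : n%:R `^ u = n%:R `^ v * n%:R `^ (u - v) :> R.
  have e : u = v + (u - v) by lra.
  rewrite {1}e powRD//; apply/implyP => _.
  by rewrite pnatr_eq0 gtn_eqF.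
have h1 : 1 <= n%:R `^ v :> R.
  by rewrite -[leLHS](powRr0 n%:R) ler_powR// ler1n.
have h2 : 1 + (u - v) / 2 <= n%:R `^ (u - v) :> R.
  rewrite natr_powR//; apply: le_trans (expR_ge1Dx _).
  by rewrite lerD2l ler_wpM2l// subr_ge0.
have d0 : 0 <= u - v by rewrite subr_ge0.
rewrite ger0_norm// ger0_norm; last first.
  rewrite subr_ge0 ler_peMr ?powR_ge0//; lra.
nra.
Qed.

Lemma nat_eq_of_dist_lt1 (g h I : nat) (z : int) : (g < I)%N -> (h < I)%N ->
  `|g%:Z - h%:Z - I%:Z * z| < 1 -> g = h.
Proof.
move=> gI hI; set w := I%:Z * z => hw; have wE : g%:Z - h%:Z = w by lia.
have [z0|[z0|z0]] : (z <= -1)%R \/ z = 0 \/ (1 <= z)%R by lia.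
- have : w <= - I%:Z by rewrite /w; nia.
  lia.
- by move: wE; rewrite /w z0; lia.
- have : I%:Z <= w by rewrite /w; nia.
  lia.
Qed.

(** The numbers [I * u g] are congruent modulo 1, so distinct [g < I] give distinct integer parts;
    those of the hits lie in a window of length about [2 l I] around one of them. *)
Lemma grid_count (I : nat) c (l : R) S : (0 < I)%N -> 0 <= l ->
  (forall u v, 0 <= u < 1 -> 0 <= v < 1 -> S u -> S v -> `|u - v| <= l) ->
  (count (fun g : nat => S (fr (c + g%:R / I%:R))) (iota 0 I))%:R
    <= 2 * (l * I%:R) + 3.
Proof.
move=> I0 l0 Sl; have IR : 0 < I%:R :> R by rewrite ltr0n.
pose u (g : nat) := fr (c + g%:R / I%:R).
have u01 g : 0 <= u g < 1 by rewrite fr_ge0 fr_lt1.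
rewrite -size_filter; set F := [seq _ <- _ | _].
have FS g : g \in F -> S (u g) by rewrite mem_filter => /andP[].
have FI g : g \in F -> (g < I)%N by rewrite mem_filter mem_iota => /and3P[].
case FE : F => [|g0 F'].
  by rewrite /= addr_ge0// mulr_ge0// mulr_ge0.
have g0F : g0 \in F by rewrite FE mem_head.
rewrite -FE; pose f g := Num.truncn (I%:R * u g).
have finj : {in F &, injective f}.
  move=> g h gF hF e.
  have Iu k : 0 <= I%:R * u k by rewrite mulr_ge0// fr_ge0.
  have := truncn_itv (Iu g); have := truncn_itv (Iu h).
  rewrite -/(f g) -/(f h) e -natr1 => /andP[a1 a2] /andP[a3 a4].
  have [z1 e1] := frE (c + g%:R / I%:R); have [z2 e2] := frE (c + h%:R / I%:R).
  rewrite -/(u g) in e1; rewrite -/(u h) in e2.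
  have e3 : I%:R * u g - I%:R * u h
      = (g%:Z - h%:Z - I%:Z * (z1 - z2))%:~R.
    have -> : u g = c + g%:R / I%:R - z1%:~R by rewrite {1}e1; ring.
    have -> : u h = c + h%:R / I%:R - z2%:~R by rewrite {1}e2; ring.
    by rewrite !(intrD, intrM, mulrNz) -!pmulrn; field; rewrite gt_eqF.
  apply: (nat_eq_of_dist_lt1 (FI _ gF) (FI _ hF) (z := z1 - z2)).
  by rewrite -(ltr_int R) intr_norm -e3 ltr_norml; apply/andP; split; lra.
have := @uniq_leq_size _ (map f F) (iota (Num.truncn (I%:R * (u g0 - l)))
  (Num.truncn (2 * (l * I%:R))).+3).
rewrite size_map size_iota map_inj_in_uniq// => h.
have lI : 0 <= 2 * (l * I%:R) by rewrite mulr_ge0// mulr_ge0.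
rewrite -addn3 -(ler_nat R) natrD in h; apply: le_trans (h _ _) _.
- by rewrite filter_uniq// iota_uniq.
- move=> _ /mapP[g gF ->].
  have := Sl _ _ (u01 g) (u01 g0) (FS _ gF) (FS _ g0F).
  rewrite ler_norml => /andP[b1 b2].
  rewrite mem_iota; apply/andP; split.
    by apply: le_truncn; rewrite ler_pM2l//; lra.
  rewrite -(ltr_nat R) natrD -addn3 natrD.
  have := truncnS_gt (I%:R * (u g0 - l)); have := truncnS_gt (2 * (l * I%:R)).
  have : (f g)%:R <= I%:R * u g by rewrite truncn_le mulr_ge0// fr_ge0.
  rewrite -!natr1; move: (Num.truncn _)%:R (Num.truncn _)%:R => w1 w2.
  nra.
by rewrite lerD2r truncn_le.
Qed.

End GridHits.

(** * Marstrand's projection estimate for words *)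

Section Marstrand.
Variable R : realType.
Variables (m q n l : nat) (X Y : set R) (t A B C1 C2 : R).
Hypotheses (m1 : (1 < m)%N) (n1 : (1 < n)%N) (t0 : t != 0).
Local Notation M := (m ^ q)%N.
Local Notation kapt := (kap n t).

Let M0 : (0 < M)%N. Proof. by rewrite expn_gt0 (ltnW m1). Qed.
Let MR : 0 < M%:R :> R. Proof. by rewrite ltr0n. Qed.
Let nR : 0 < n%:R :> R. Proof. by rewrite ltr0n (ltnW n1). Qed.
Let mR : 0 < m%:R :> R. Proof. by rewrite ltr0n (ltnW m1). Qed.
Let at0 : 0 < `|t|. Proof. by rewrite normr_gt0. Qed.
Let kap0 : 0 < kapt. Proof. by rewrite /kap ltr_wpDr// mulr_ge0. Qed.

(** Small enough that [|dy| <= slope_const * d] implies [|t| n |dy| <= d / 2], whatever the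
    phase. *)
Definition slope_const : R := (2 * (`|t| * n%:R) + 2)^-1.
(** The summands serve the cases of [hit_count]: 5 covers [k = q] and the additive 3 of
    [grid_count], the next one dominant [dx], the last one transversal [dy]. *)
Definition hit_const : R :=
  5 + 2 * kapt * m%:R + 8 * kapt * m%:R / (`|t| * slope_const).

Lemma slope_const_gt0 : 0 < slope_const.
Proof. by rewrite invr_gt0 ltr_wpDl// !mulr_ge0. Qed.

Lemma hit_const_ge1 : 1 <= hit_const.
Proof.
have c0 := slope_const_gt0.
have h1 : 0 <= 2 * kapt * m%:R by rewrite !mulr_ge0// ltW.
have h2 : 0 <= 8 * kapt * m%:R / (`|t| * slope_const).
  by rewrite !mulr_ge0 ?invr_ge0 ?mulr_ge0// ltW.
rewrite /hit_const; lra.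
Qed.

Lemma angle_bound u : u < 1 -> `|angle n t u| <= `|t| * n%:R.
Proof.
move=> u1; rewrite normrM ler_wpM2l// ger0_norm ?powR_ge0//.
rewrite -[leRHS](powRr1 (ltW nR)).
by apply: ler_powR; rewrite ?ler1n ?(ltnW n1)// ltW.
Qed.

(* The angles [t n^u] at which [(dx, dy)] projects to within [kapt / M] of 0 fill
   an interval of length comparable with [1 / (M max(|dx|, |dy|))]. *)
Lemma hit_count (c dx dy : R) (k I : nat) : (k <= q)%N ->
  k = q \/ (m ^ k.+1)%:R^-1 < Num.max `|dx| `|dy| -> (3 * M <= I)%N ->
  (count (fun g : nat => `|dx + angle n t (fr (c + g%:R / I%:R)) * dy| <= kapt / M%:R)
    (iota 0 I))%:R <= hit_const * I%:R * ((m ^ k)%:R / M%:R).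
Proof.
move=> kq hk MI; set S : pred R := fun u => `|dx + angle n t u * dy| <= kapt / M%:R.
have I0 : (0 < I)%N by rewrite (leq_trans _ MI)// muln_gt0.
have IR : 0 < I%:R :> R by rewrite ltr0n.
have c0 := slope_const_gt0.
set cn : R := (count _ _)%:R.
have cnI : cn <= I%:R.
  by rewrite ler_nat -[leqRHS](size_iota 0) count_size.
have mk0 : 0 < (m ^ k)%:R :> R by rewrite ltr0n expn_gt0 (ltnW m1).
have mk1 : 1 <= (m ^ k)%:R :> R by rewrite ler1n expn_gt0 (ltnW m1).
set w := (m ^ k)%:R / M%:R; have w0 : 0 < w by rewrite divr_gt0.
have Iw0 : 0 < I%:R * w by rewrite mulr_gt0.
have Iw3 : 3 <= I%:R * w.
  rewrite /w mulrA ler_pdivlMr//.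
  have : 3 * M%:R <= I%:R :> R by rewrite -natrM ler_nat.
  by nra.
have h1 : 0 <= 2 * kapt * m%:R by rewrite !mulr_ge0// ltW.
have h2 : 0 <= 8 * kapt * m%:R / (`|t| * slope_const).
  by rewrite !mulr_ge0 ?invr_ge0 ?mulr_ge0// ltW.
rewrite -mulrA.
case: hk => [kE|hk].
  have w1 : w = 1 by rewrite /w kE divff// gt_eqF.
  rewrite (le_trans cnI)// w1 mulr1 ler_peMl ?hit_const_ge1// ltW.
have mkE : (m ^ k.+1)%:R = m%:R * (m ^ k)%:R :> R by rewrite expnS natrM.
set d : R := (m ^ k.+1)%:R^-1 in hk.
have d0 : 0 < d by rewrite invr_gt0 ltr0n expn_gt0 (ltnW m1).
have dm : m%:R * (m ^ k)%:R * d = 1.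
  by rewrite -mkE /d divff// pnatr_eq0 expn_eq0 gtn_eqF// (ltnW m1).
(* When [dx] dominates, a hit forces [d / 2 <= kapt / M], so [w] is bounded below and the trivial
   bound [I] suffices. *)
have [dyle|dygt] := leP `|dy| (slope_const * d).
  have [/hasP[g _ hg]|nog] := boolP (has (fun g : nat => S (fr (c + g%:R / I%:R))) (iota 0 I)); last first.
    have -> : cn = 0.
      by apply/eqP; rewrite pnatr_eq0 -leqn0 leqNgt -has_count.
    by rewrite mulr_ge0 ?(ltW Iw0)// (le_trans _ hit_const_ge1).
  have c1 : slope_const * (`|t| * n%:R) <= 2^-1.
    have : slope_const * (2 * (`|t| * n%:R) + 2) = 1.
      by rewrite mulVf// gt_eqF// ltr_wpDl// !mulr_ge0.
    by move: c0; lra.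
  have c2 : slope_const <= 2^-1.
    rewrite lef_pV2 ?posrE// ?lerDr ?ltr_wpDl// ?mulr_ge0// ?mulr_ge0//.
  have dxd : d < `|dx|.
    move: hk; rewrite lt_max => /orP[//|]; rewrite ltNge => /negP[].
    apply: le_trans dyle _; have := c2; nra.
  have : `|dx| <= kapt / M%:R + `|t| * n%:R * `|dy|.
    rewrite -[dx](addrK (angle n t (fr (c + g%:R / I%:R)) * dy)).
    rewrite (le_trans (ler_normB _ _))// lerD// normrM ler_wpM2r//.
    by rewrite angle_bound// fr_lt1.
  have : `|t| * n%:R * `|dy| <= d / 2.
    apply: (@le_trans _ _ (`|t| * n%:R * (slope_const * d))).
      by rewrite ler_wpM2l// mulr_ge0.
    by move: c1; nra.
  move=> b1 b2; have b3 : d / 2 <= kapt / M%:R by lra.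
  have b4 : 1 <= 2 * kapt * m%:R * w.
    have -> : 2 * kapt * m%:R * w = 2 * (m%:R * (m ^ k)%:R) * (kapt / M%:R).
      by rewrite /w; ring.
    have mm : 0 < m%:R * (m ^ k)%:R :> R by rewrite mulr_gt0.
    by have := ler_wpM2l (ltW mm) b3; move: dm; lra.
  rewrite (le_trans cnI)// -[leLHS]mulr1 mulrCA ler_pM2l//.
  apply: (le_trans b4); rewrite ler_wpM2r ?(ltW w0)// /hit_const; lra.
have dy0 : 0 < `|dy| by apply: lt_trans dygt; rewrite mulr_gt0.
(* Two hits have angles within [2 (kapt / M) / |dy|] of each other; [powR_sub_ge] passes to phases
   at the price of another factor 2. *)
pose ell : R := 4 * (kapt / M%:R) / (`|t| * `|dy|).
have kM0 : 0 < kapt / M%:R by rewrite divr_gt0.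
have ell0 : 0 <= ell by rewrite !mulr_ge0 ?invr_ge0 ?mulr_ge0// ltW.
have := @grid_count R I c ell S I0 ell0.
have -> : (count (fun g : nat => S (fr (c + g%:R / I%:R))) (iota 0 I))%:R = cn by [].
move=> H; apply: le_trans (H _) _.
  move=> u v /andP[u0 u1] /andP[v0 v1] Su Sv.
  apply: le_trans (powR_sub_ge n1 u0 v0) _.
  rewrite /ell ler_pdivlMr ?mulr_gt0//.
  have : `|(angle n t u - angle n t v) * dy| <= 2 * (kapt / M%:R).
    have -> : (angle n t u - angle n t v) * dy =
      (dx + angle n t u * dy) - (dx + angle n t v * dy) by ring.
    rewrite (le_trans (ler_normB _ _))// mulr_natl mulr2n lerD//.
  rewrite /angle -mulrBr !normrM; nra.
have ellw : ell <= 4 * kapt * m%:R / (`|t| * slope_const) * w.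
  rewrite /ell ler_pdivrMr ?mulr_gt0//.
  have -> : 4 * kapt * m%:R / (`|t| * slope_const) * w * (`|t| * `|dy|)
    = 4 * (kapt / M%:R) * ((m%:R * (m ^ k)%:R) * (`|dy| / slope_const)).
    rewrite /w; field; rewrite !gt_eqF//.
  apply: ler_peMr; first by rewrite mulr_ge0// ltW.
  rewrite -[leLHS]dm ler_wpM2l ?mulr_ge0//.
  by rewrite ler_pdivlMr// mulrC ltW.
have : ell * I%:R <= 4 * kapt * m%:R / (`|t| * slope_const) * w * I%:R.
  by rewrite ler_wpM2r// ltW.
rewrite /hit_const; nra.
Qed.

Hypotheses (X1 : unit_set X) (Y1 : unit_set Y) (Xm : stable m X) (Yn : stable n Y).
Hypotheses (A0 : 0 <= A) (B0 : 0 <= B) (C10 : 0 < C1) (C20 : 0 < C2)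
  (cntX_le : forall k, (cnt (m ^ k) X)%:R <= C1 * (m ^ k)%:R `^ A)
  (cntY_le : forall k, (cnt (n ^ k) Y)%:R <= C2 * (n ^ k)%:R `^ B).
Hypotheses (M_le_nl : (M <= n ^ l)%N) (nl_le : (n ^ l <= n * M)%N).
Variable g : R.
Hypotheses (g0 : 0 <= g) (gAB : A + B - 1 <= g).

Let mX0 k : (0 < m ^ k)%N. Proof. by rewrite expn_gt0 (ltnW m1). Qed.
Let nX0 k : (0 < n ^ k)%N. Proof. by rewrite expn_gt0 (ltnW n1). Qed.

Lemma countX_le (x : R) k : (k <= q)%N ->
  (count (fun w : nat => `|x - w%:R / M%:R| <= (m ^ k)%:R^-1) (ws M X))%:R
    <= 3 * C1 * (m ^ (q - k))%:R `^ A.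
Proof.
move=> kq; have := @count_ball R (m ^ k) (m ^ (q - k)) X x (mX0 _) (mX0 _) X1.
move=> /(_ (stableX k X1 Xm)); rewrite -expnD subnKC// -(ler_nat R) natrM => h.
by apply: (le_trans h); rewrite -mulrA ler_pM2l.
Qed.

(** The scale [m^-k] need not be a power of [n]. The factor [n ^ 2] covers its rounding to [n^-j],
    where [n ^ j <= m ^ k < n ^ j.+1], and the rounding of [M] to [n ^ l]. *)
Lemma countY_le (y : R) k : (k <= q)%N ->
  (count (fun v : nat => `|y - v%:R / (n ^ l)%:R| <= (m ^ k)%:R^-1) (ws (n ^ l) Y))%:R
    <= 3 * C2 * (n ^ 2)%:R `^ B * (m ^ (q - k))%:R `^ B.
Proof.
move=> kq; have mkR : 0 < (m ^ k)%:R :> R by rewrite ltr0n.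
have i0 : 0 < (m ^ k)%:R^-1 :> R by rewrite invr_gt0.
have i1 : (m ^ k)%:R^-1 <= 1 :> R by rewrite invf_le1// ler1n.
have [] := logrP n1 i0 i1; set j := logr n _.
rewrite ler_pdivrMr// mul1r ltr_pdivlMr// mul1r ler_nat ltr_nat => h1 h2.
have jl : (j <= l)%N.
  rewrite -(leq_exp2l _ _ n1) (leq_trans h1)// (leq_trans _ M_le_nl)//.
  by rewrite leq_exp2l.
have := @count_ball R (n ^ j) (n ^ (l - j)) Y y (nX0 _) (nX0 _) Y1.
move=> /(_ (stableX j Y1 Yn)); rewrite -expnD subnKC// -(ler_nat R) natrM => h.
apply: (@le_trans _ _ (3 * (cnt (n ^ (l - j)) Y)%:R)).
  apply: le_trans h; rewrite ler_nat; apply: sub_count => v /= hv.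
  by apply: (le_trans hv); rewrite lef_pV2 ?posrE ?ltr0n// ler_nat.
rewrite -!mulrA ler_pM2l//; apply: (le_trans (cntY_le _)).
rewrite ler_pM2l// -powRM//; apply: ge0_ler_powR; rewrite ?nnegrE//.
rewrite -natrM ler_nat -(leq_pmul2l (nX0 j)) -expnD subnKC// (leq_trans nl_le)//.
rewrite -{1}(subnKC kq) expnD -mulnn.
have -> : (n ^ j * (n * n * m ^ (q - k)) = n * (n * n ^ j * m ^ (q - k)))%N by ring.
by rewrite leq_mul2l leq_mul2r -expnS (ltnW h2) !orbT.
Qed.

Lemma natr_count (T : Type) (P : pred T) (s : seq T) :
  (count P s)%:R = \sum_(x <- s) (P x)%:R :> R.
Proof. by elim: s => [|x s IH] /=; rewrite ?big_nil// big_cons natrD IH. Qed.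

Definition avg_const : R := hit_const * (9 * C1 * C2 * (n ^ 2)%:R `^ B).

(** [hit_count] applies at the largest [k <= q] for which both coordinates are within [m^-k]; the
    sum over all scales contains that term. *)
Lemma word_hits (c x y : R) (I : nat) (wv : nat * nat) : (3 * M <= I)%N ->
  0 <= x < 1 -> 0 <= y < 1 -> wv \in words M n l X Y ->
  (count (fun i : nat => near M n l t (angle n t (fr (c + i%:R / I%:R))) x y wv)
    (iota 0 I))%:R <= hit_const * I%:R * \sum_(k <- iota 0 q.+1)
    (m ^ k)%:R / M%:R * ((`|x - wv.1%:R / M%:R| <= (m ^ k)%:R^-1)%R%:R
     * (`|y - wv.2%:R / (n ^ l)%:R| <= (m ^ k)%:R^-1)%R%:R).
Proof.
move=> MI /andP[x0 x1] /andP[y0 y1] /allpairsP[[w v] /= [wW vV ->]] /=.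
set dx := x - _; set dy := y - _.
have frac (z : R) (N i : nat) : 0 <= z -> z < 1 -> (i < N)%N ->
    `|z - i%:R / N%:R| <= 1.
  move=> z0 z1 iN; have NR : 0 < N%:R :> R by rewrite ltr0n (leq_ltn_trans _ iN).
  have a0 : 0 <= i%:R / N%:R :> R by rewrite divr_ge0.
  have a1 : i%:R / N%:R < 1 :> R by rewrite ltr_pdivrMr// mul1r ltr_nat.
  by rewrite ler_norml; apply/andP; split; lra.
have dx1 : `|dx| <= 1 by apply: frac => //; exact: ws_lt wW.
have dy1 : `|dy| <= 1 by apply: frac => //; exact: ws_lt vV.
pose P k := (k <= q)%N && (Num.max `|dx| `|dy| <= (m ^ k)%:R^-1).
have exP : exists k, P k.
  by exists 0%N; rewrite /P /= expn0 invr1 ge_max dx1 dy1.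
have leP' k : P k -> (k <= q)%N by move=> /andP[].
have [k /andP[kq kd] kmax] := ex_maxnP exP leP'.
have hk : k = q \/ (m ^ k.+1)%:R^-1 < Num.max `|dx| `|dy|.
  move: kq; rewrite leq_eqVlt => /orP[/eqP|kq]; [by left|right].
  rewrite ltNge; apply/negP => h; have := kmax k.+1.
  by rewrite /P kq h ltnn => /(_ isT).
apply: le_trans (hit_count c kq hk MI) _.
rewrite ler_pM2l; last first.
  rewrite mulr_gt0// ?ltr0n ?(leq_trans _ MI) ?muln_gt0//.
  by apply: lt_le_trans hit_const_ge1.
move: kd; rewrite ge_max => /andP[kx ky].
have kI : k \in iota 0 q.+1 by rewrite mem_iota add0n ltnS.
rewrite (big_rem k kI) /= kx ky !mulr1 lerDl; apply: sumr_ge0 => i _.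
by rewrite !mulr_ge0.
Qed.

(** Within [m^-k] of [(x, y)] there are at most about [m ^ ((q - k) (A + B))] words, each hit at a
    proportion at most about [m ^ (k - q)] of the angles. As [0 <= g] and [A + B - 1 <= g], each of
    the [q + 1] scales contributes at most a constant times [M ^ g]. *)
Lemma mult_average (c x y : R) (I : nat) : (3 * M <= I)%N ->
  0 <= x < 1 -> 0 <= y < 1 ->
  \sum_(i <- iota 0 I) (mult M n l X Y t (angle n t (fr (c + i%:R / I%:R))) x y)%:R
    <= avg_const * q.+1%:R * M%:R `^ g * I%:R.
Proof.
move=> MI hx hy.
under eq_bigr do rewrite natr_count.
rewrite exchange_big /=.
under eq_bigr do rewrite -natr_count.
apply: (@le_trans _ _ (\sum_(wv <- words M n l X Y) hit_const * I%:R *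
   \sum_(k <- iota 0 q.+1)
    (m ^ k)%:R / M%:R * ((`|x - wv.1%:R / M%:R| <= (m ^ k)%:R^-1)%R%:R
     * (`|y - wv.2%:R / (n ^ l)%:R| <= (m ^ k)%:R^-1)%R%:R))).
  rewrite big_seq [leRHS]big_seq; apply: ler_sum => wv wvW.
  exact: word_hits.
rewrite -mulr_sumr exchange_big /=.
set D : R := 9 * C1 * C2 * (n ^ 2)%:R `^ B.
have D0 : 0 <= D by rewrite !mulr_ge0 ?powR_ge0// ltW.
have key k : (k <= q)%N -> \sum_(wv <- words M n l X Y)
    (m ^ k)%:R / M%:R * ((`|x - wv.1%:R / M%:R| <= (m ^ k)%:R^-1)%R%:R
     * (`|y - wv.2%:R / (n ^ l)%:R| <= (m ^ k)%:R^-1)%R%:R) <= D * M%:R `^ g.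
  move=> kq; rewrite -mulr_sumr /words big_allpairs /=.
  under eq_bigr do rewrite -mulr_sumr -natr_count.
  rewrite -mulr_suml -natr_count.
  have mkR : 0 < (m ^ k)%:R :> R by rewrite ltr0n.
  have mqk : 0 < (m ^ (q - k))%:R :> R by rewrite ltr0n.
  have mqk1 : 1 <= (m ^ (q - k))%:R :> R by rewrite ler1n.
  have e1 : (m ^ k)%:R / M%:R = (m ^ (q - k))%:R^-1 :> R.
    by rewrite -{1}(subnKC kq) expnD natrM invfM mulrA divff ?mul1r// gt_eqF.
  rewrite e1 mulrC ler_pdivrMr//.
  apply: (le_trans (ler_pM (ler0n _ _) (ler0n _ _) (countX_le x kq) (countY_le y kq))).
  have -> : 3 * C1 * (m ^ (q - k))%:R `^ A * (3 * C2 * (n ^ 2)%:R `^ B * (m ^ (q - k))%:R `^ B)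
     = D * ((m ^ (q - k))%:R `^ A * (m ^ (q - k))%:R `^ B) by rewrite /D; ring.
  rewrite -[leRHS]mulrA; apply: ler_wpM2l => //.
  have imp (u v : R) : (u + v == 0) ==> ((m ^ (q - k))%:R != 0 :> R).
    by apply/implyP => _; rewrite gt_eqF.
  rewrite -powRD//; apply: (@le_trans _ _ ((m ^ (q - k))%:R `^ (g + 1))).
    by apply: ler_powR => //; move: gAB; lra.
  rewrite powRD// powRr1 ?(ltW mqk)// ler_pM2r//.
  apply: ge0_ler_powR; rewrite ?nnegrE//.
  by rewrite ler_nat leq_exp2l// leq_subr.
have hs : \sum_(k <- iota 0 q.+1) \sum_(wv <- words M n l X Y)
    (m ^ k)%:R / M%:R * ((`|x - wv.1%:R / M%:R| <= (m ^ k)%:R^-1)%R%:R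
     * (`|y - wv.2%:R / (n ^ l)%:R| <= (m ^ k)%:R^-1)%R%:R) <= q.+1%:R * (D * M%:R `^ g).
  apply: (@le_trans _ _ (\sum_(k <- iota 0 q.+1) D * M%:R `^ g)).
    rewrite big_seq [leRHS]big_seq; apply: ler_sum => k.
    rewrite mem_iota add0n ltnS => kq; exact: key.
  by rewrite big_const_seq count_predT size_iota iter_addr_0 mulr_natl.
have hI : 0 <= hit_const * I%:R.
  by rewrite mulr_ge0// (le_trans _ hit_const_ge1).
apply: (le_trans (ler_wpM2l hI hs)).
rewrite le_eqVlt; apply/orP; left; apply/eqP; rewrite /avg_const -/D; ring.
Qed.

End Marstrand.

(** * Averaging over the initial phase *)

Section Averaging.
Variable R : realType.

(** For some [i] the average of [f i] over [E] is at most [b]; by Markov's inequality at least half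
    of [E] then satisfies [f i p <= 2 * b]. *)
Lemma exists_good_index (T : eqType) (E : seq T) (f : nat -> T -> R) (I : nat) (b : R) :
  (0 < I)%N -> 0 < b -> (forall i p, 0 <= f i p) ->
  (forall p, p \in E -> \sum_(i <- iota 0 I) f i p <= I%:R * b) ->
  exists2 i, (i < I)%N &
    (size E <= 2 * size [seq p <- E | (f i p <= 2 * b)%R])%N.
Proof.
move=> I0 b0 f0 fE; apply: contrapT => H.
have {}H i : (i < I)%N -> (size E)%:R * b < \sum_(p <- E) f i p.
  move=> iI; rewrite ltNge; apply/negP => h; apply: H; exists i => //.
  rewrite size_filter -(count_predC (fun p => f i p <= 2 * b) E) mul2n -addnn leq_add2l.
  rewrite -(ler_nat R) -(ler_pM2r b0).
  have h1 : (count (predC (fun p => f i p <= 2 * b)) E)%:R * (2 * b) <= \sum_(p <- E) f i p.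
    rewrite natr_count mulr_suml; apply: ler_sum => p _ /=.
    by case: (leP (f i p) (2 * b)) => h' /=; rewrite ?mulr0n ?mulr1n ?mul0r ?mul1r ?f0// ltW.
  have : (size E)%:R = (count (fun p => f i p <= 2 * b) E)%:R
      + (count (predC (fun p => f i p <= 2 * b)) E)%:R :> R.
    by rewrite -natrD count_predC.
  move=> e; rewrite e in h; nra.
have h1 : \sum_(i <- iota 0 I) \sum_(p <- E) f i p <= (size E)%:R * (I%:R * b).
  rewrite exchange_big /=.
  apply: (@le_trans _ _ (\sum_(p <- E) I%:R * b)).
    by rewrite big_seq [leRHS]big_seq; apply: ler_sum => p; exact: fE.
  by rewrite big_const_seq count_predT iter_addr_0 -[leLHS]mulr_natl.
have h2 : \sum_(i <- iota 0 I) (size E)%:R * b < \sum_(i <- iota 0 I) \sum_(p <- E) f i p.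
  have -> : I = I.-1.+1 by rewrite prednK.
  rewrite /= !big_cons; apply: ltr_leD; first exact: H.
  rewrite big_seq [leRHS]big_seq; apply: ler_sum => i; rewrite mem_iota => /andP[_ hi].
  by apply/ltW/H; rewrite (leq_trans hi)// add1n prednK.
have := lt_le_trans h2 h1.
rewrite big_const_seq count_predT size_iota iter_addr_0 -[X in X < _]mulr_natl.
by rewrite mulrCA ltxx.
Qed.

Definition point_of N (Z : set R) (w : nat) : R := xget 0 [set z | Z z /\ dg N z = w].

Lemma point_ofP N (Z : set R) w : w \in ws N Z ->
  Z (point_of N Z w) /\ dg N (point_of N Z w) = w.
Proof.
move=> /wsP[z Zz zw]; rewrite /point_of; case: xgetP => [y -> //|/(_ z)].
by case.
Qed.

Lemma word_points (N N' : nat) (X Y : set R) : exists E : seq (R * R), [/\ uniq E,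
  size E = (cnt N X * cnt N' Y)%N, forall p, p \in E -> in_sets X Y p &
  forall p p', p \in E -> p' \in E -> dg N p.1 = dg N p'.1 ->
    dg N' p.2 = dg N' p'.2 -> p = p'].
Proof.
exists [seq (point_of N X w, point_of N' Y v) | w <- ws N X, v <- ws N' Y]; split.
- apply: allpairs_uniq => //; [exact: ws_uniq|exact: ws_uniq|].
  move=> [w v] [w' v'] /allpairsP[[a b] /= [aX bY [-> ->]]].
  move=> /allpairsP[[a' b'] /= [aX' bY' [-> ->]]] /= [e1 e2].
  have [_ <-] := point_ofP aX; have [_ <-] := point_ofP aX'.
  have [_ <-] := point_ofP bY; have [_ <-] := point_ofP bY'.
  by rewrite e1 e2.
- by rewrite size_allpairs.
- move=> p /allpairsP[[w v] /= [wX vY ->]].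
  by split; [have [] := point_ofP wX|have [] := point_ofP vY].
- move=> p p' /allpairsP[[w v] /= [wX vY ->]] /allpairsP[[w' v'] /= [wX' vY' ->]] /=.
  have [_ ->] := point_ofP wX; have [_ ->] := point_ofP wX'.
  have [_ ->] := point_ofP vY; have [_ ->] := point_ofP vY'.
  by move=> -> ->.
Qed.

End Averaging.

Section BadAverage.
Variable R : realType.
Variables (m q n l : nat) (X Y : set R) (t A B C1 C2 g lam : R).
Hypotheses (m1 : (1 < m)%N) (n1 : (1 < n)%N) (t0 : t != 0).
Local Notation M := (m ^ q)%N.
Hypotheses (X1 : unit_set X) (Y1 : unit_set Y) (Xm : stable m X) (Yn : stable n Y).
Hypotheses (A0 : 0 <= A) (B0 : 0 <= B) (C10 : 0 < C1) (C20 : 0 < C2)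
  (cntX_le : forall k, (cnt (m ^ k) X)%:R <= C1 * (m ^ k)%:R `^ A)
  (cntY_le : forall k, (cnt (n ^ k) Y)%:R <= C2 * (n ^ k)%:R `^ B).
Hypotheses (M_le_nl : (M <= n ^ l)%N) (nl_le : (n ^ l <= n * M)%N).
Hypotheses (g0 : 0 <= g) (gAB : A + B - 1 <= g) (lam0 : 0 <= lam).
Variables (mm I : nat) (e : R).
Hypotheses (e0 : 0 < e) (MI : (3 * M <= I)%N) (mm0 : (0 < mm)%N)
  (mmP : 2 * (avg_const m n t B C1 C2 * q.+1%:R * M%:R `^ g) <= e * mm%:R).

Lemma ypos_grid (a i : nat) : (i < I)%N ->
  ypos lam (i%:R / I%:R) a = Num.truncn (a%:R * lam) \/
  ypos lam (i%:R / I%:R) a = (Num.truncn (a%:R * lam)).+1.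
Proof.
move=> iI; have I0 : 0 < I%:R :> R by rewrite ltr0n (leq_ltn_trans _ iI).
have a0 : 0 <= a%:R * lam by rewrite mulr_ge0.
have i0 : 0 <= i%:R / I%:R :> R by rewrite divr_ge0.
have i1 : i%:R / I%:R < 1 :> R by rewrite ltr_pdivrMr// mul1r ltr_nat.
have := truncn_itv a0; have := truncn_itv (addr_ge0 a0 i0).
rewrite /ypos; set u := Num.truncn _; set b := Num.truncn _.
move=> /andP[h1 h2] /andP[h3 h4].
have h5 : (b <= u)%N by rewrite -ltnS -(ltr_nat R); lra.
have h6 : (u <= b.+1)%N by rewrite -ltnS -(ltr_nat R) -(natr1 b.+1); lra.
move: h6; rewrite leq_eqVlt ltnS => /orP[/eqP|ub]; [by right|left].
by apply/eqP; rewrite eqn_leq ub.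
Qed.

(** As the initial phase varies, [ypos] takes at most two values, so the tails take at most two
    positions while the angle runs over a grid. [mult_average] and Markov's inequality apply to
    each, whence the factor 2 in [mmP]. *)
Lemma bad_average (a : nat) (p : R * R) : in_sets X Y p ->
  \sum_(i <- iota 0 I) (bad M n l X Y t lam mm (i%:R / I%:R) a p)%:R <= I%:R * e.
Proof.
move=> [Xp Yp].
pose y (b : nat) : R := fr ((n ^ b)%:R * p.2).
pose F b i : R := (mult M n l X Y t (angle n t (fr (a%:R * lam + i%:R / I%:R))) (xtail M a p) (y b))%:R.
set b0 := Num.truncn (a%:R * lam).
have mmR : 0 < mm%:R :> R by rewrite ltr0n.
have h1 : \sum_(i <- iota 0 I) (bad M n l X Y t lam mm (i%:R / I%:R) a p)%:R * mm%:R
   <= \sum_(i <- iota 0 I) (F b0 i + F b0.+1 i).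
  rewrite big_seq [leRHS]big_seq; apply: ler_sum => i; rewrite mem_iota add0n => iI.
  rewrite /bad; case: ltnP => hb; last by rewrite mulr0n mul0r addr_ge0.
  rewrite mulr1n mul1r.
  have [e1|e1] := @ypos_grid a i iI; move: hb; rewrite /ytail e1 => hb.
    by apply: (@le_trans _ _ (F b0 i)); rewrite ?lerDl// ler_nat ltnW.
  by apply: (@le_trans _ _ (F b0.+1 i)); rewrite ?lerDr// ler_nat ltnW.
have hF b : \sum_(i <- iota 0 I) F b i <= avg_const m n t B C1 C2 * q.+1%:R * M%:R `^ g * I%:R.
  apply: (@mult_average R m q n l X Y t A B C1 C2) => //.
    by rewrite fr_ge0 fr_lt1.
  by rewrite fr_ge0 fr_lt1.
have h2 := hF b0; have h3 := hF b0.+1.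
rewrite -(ler_pM2r mmR) mulr_suml; apply: (le_trans h1); rewrite big_split /=.
have IR : 0 <= I%:R :> R by [].
move: mmP h2 h3; set T := _ * M%:R `^ g => h4 h2 h3.
have : I%:R * (2 * T) <= I%:R * (e * mm%:R) by rewrite ler_wpM2l.
lra.
Qed.

End BadAverage.

(** * The lower bound *)

Section LowerBound.
Variable R : realType.

Lemma ln_le_subr1 (u : R) : 0 < u -> ln u <= u - 1.
Proof. by move=> u0; have := expR_ge1Dx (ln u); rewrite lnK ?posrE//; lra. Qed.

Lemma le_nat_truncn (x : R) : x <= (Num.truncn x).+1%:R.
Proof. exact/ltW/truncnS_gt. Qed.

Lemma lnM_pos (u v : R) : 0 < u -> 0 < v -> ln (u * v) = ln u + ln v.
Proof. by move=> u0 v0; rewrite lnM. Qed.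

Lemma le_ln_pos (u v : R) : 0 < u -> u <= v -> ln u <= ln v.
Proof. by move=> u0 uv; rewrite ler_ln ?posrE// (lt_le_trans u0). Qed.

Lemma exists_log_le_linear (a C : R) : 0 < a ->
  exists2 q : nat, (0 < q)%N & C + ln q.+1%:R <= a * q%:R.
Proof.
move=> a0; pose c := a / 2; have c0 : 0 < c by rewrite divr_gt0.
exists (Num.truncn ((C + c - 1 - ln c) / c)).+1 => //.
set q := (Num.truncn _).+1.
have hq : C + c - 1 - ln c <= c * q%:R.
  by rewrite mulrC -ler_pdivrMr// le_nat_truncn.
have q0 : 0 < q.+1%:R :> R by rewrite ltr0n.
have : ln (q.+1%:R * c) <= q.+1%:R * c - 1 by rewrite ln_le_subr1// mulr_gt0.
rewrite lnM ?posrE// -[q.+1%:R in X in _ <= X]natr1.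
have -> : a = 2 * c by rewrite /c; field.
lra.
Qed.

Lemma ln_expn (b k : nat) : (0 < b)%N -> ln (b ^ k)%:R = k%:R * ln b%:R :> R.
Proof. by move=> b0; rewrite natrX lnXn ?mulr_natl// ltr0n. Qed.

(** [c] may be negative: it will be an exponent slightly below a dimension that may be 0. *)
Lemma ler_mul_truncn (c x y : R) : 0 <= x -> 0 <= y ->
  c * (x * y) - `|c| * y <= c * ((Num.truncn x)%:R * y).
Proof.
move=> x0 y0; have /andP[l1 l2] := truncn_itv x0; rewrite -natr1 in l2.
have : `|c * ((x - (Num.truncn x)%:R) * y)| <= `|c| * y.
  rewrite normrM ler_wpM2l// ger0_norm; last by rewrite mulr_ge0 ?subr_ge0.
  by rewrite ler_piMl//; lra.
rewrite ler_norml => /andP[_]; lra.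
Qed.

(** The constants are chosen in this order: the proportion [e] of bad blocks, the block length [q],
    the tolerance [eta] with its return time [G], the minimal stage length [L0], the cover, and last
    the number [K] of blocks. *)
Lemma sumset_not_small_cover (m n : nat) (X Y : set R)
    (t A B A' B' C1 C2 s g : R) :
  (1 < m)%N -> (1 < n)%N -> t != 0 ->
  (forall q, (0 < q)%N -> nonresonant (ln (m ^ q)%:R / ln n%:R : R)) ->
  unit_set X -> unit_set Y -> X !=set0 -> Y !=set0 ->
  stable m X -> stable n Y -> 0 <= A -> 0 <= B -> 0 < C1 -> 0 < C2 ->
  (forall k, (cnt (m ^ k) X)%:R <= C1 * (m ^ k)%:R `^ A) ->
  (forall k, (cnt (n ^ k) Y)%:R <= C2 * (n ^ k)%:R `^ B) ->
  (forall k, (m ^ k)%:R `^ A' <= (cnt (m ^ k) X)%:R) ->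
  (forall k, (n ^ k)%:R `^ B' <= (cnt (n ^ k) Y)%:R) ->
  0 <= g -> A + B - 1 <= g -> 0 < s -> g + s < A' + B' ->
  ~ small_cover s [set x + t * y | x in X & y in Y].
Proof.
move=> m1 n1 t0 irr X1 Y1 X0 Y0 Xm Yn A0 B0 C10 C20 cX cY cX' cY' g0 gAB s0 hgs SC.
have m0 := ltnW m1; have n0 := ltnW n1.
have nR : 0 < n%:R :> R by rewrite ltr0n.
pose kp := A' + B' - g - s; have kp0 : 0 < kp by rewrite /kp; lra.
have Lm0 : 0 < ln m%:R :> R by rewrite ln_gt0 ?ltr1n.
have Ln0 : 0 < ln n%:R :> R by rewrite ln_gt0 ?ltr1n.
(* The surplus [kp * LM] per block is spent in quarters; the leading part [4 e LM] of the cost of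
   bad blocks is one of them. *)
pose e := kp / 16; have e0 : 0 < e by rewrite divr_gt0.
pose avg := avg_const m n t B C1 C2.
have avg0 : 0 <= avg.
  rewrite /avg /avg_const !mulr_ge0 ?powR_ge0 ?(ltW C10) ?(ltW C20)//.
  by apply: (le_trans ler01); apply: hit_const_ge1.
pose C3 := 2 * (2 * avg / e + 1).
have C30 : 0 < C3.
  have : 0 <= 2 * avg / e by rewrite divr_ge0 ?(ltW e0)// mulr_ge0.
  by rewrite /C3; lra.
(* A second quarter pays for the constants and for [ln q.+1], which grows more slowly than the
   block. *)
have [q q0 hq] := @exists_log_le_linear (kp * ln m%:R / 4)
  (ln C3 + 2 * e * ln (2 * n%:R)) (divr_gt0 (mulr_gt0 kp0 Lm0) (ltr0n _ 4)).
have [M ME] : exists M, M = (m ^ q)%N by exists (m ^ q)%N.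
have M1 : (1 < M)%N by rewrite ME -{1}(exp1n q) ltn_exp2r.
have M0 := ltnW M1; have MR : 0 < M%:R :> R by rewrite ltr0n.
have MR1 : 1 <= M%:R :> R by rewrite ler1n.
pose LM : R := ln M%:R; have LM0 : 0 < LM by rewrite ln_gt0 ?ltr1n.
have LME : LM = q%:R * ln m%:R by rewrite /LM ME ln_expn.
pose lam := LM / ln n%:R; have lam0 : 0 < lam by rewrite divr_gt0.
have lamE : lam * ln n%:R = LM by rewrite /lam divfK ?gt_eqF.
have [l lam_l l_lam] : exists2 l : nat, lam < l%:R & l%:R <= lam + 1.
  exists (Num.truncn lam).+1; first exact: truncnS_gt.
  by rewrite -natr1 lerD2r truncn_le ltW.
have MX : stable M X by rewrite ME; exact: stableX.
have irrM : nonresonant lam by rewrite /lam /LM ME; exact: irr.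
have Mnl : (M <= n ^ l)%N.
  by rewrite -(ler_nat R); exact: (M_lt_nl M1 n1 lamE lam_l).
have nlM : (n ^ l <= n * M)%N.
  rewrite -(ler_nat R) natrM -ler_ln ?posrE ?mulr_gt0 ?ltr0n ?expn_gt0 ?n0//.
  rewrite ln_expn// lnM_pos// -/LM -lamE.
  have := ler_wpM2r (ltW Ln0) l_lam; lra.
pose T1 := avg * q.+1%:R * M%:R `^ g.
have Mg1 : 1 <= M%:R `^ g by rewrite -[leLHS](powRr0 M%:R) ler_powR.
have T10 : 0 <= T1 by rewrite /T1; apply: mulr_ge0 (powR_ge0 _ _); exact: mulr_ge0.
have [mm [mmR mmP mm_le]] : exists mm : nat, [/\ 0 < mm%:R :> R,
    2 * T1 <= e * mm%:R & mm%:R <= 2 * T1 / e + 1].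
  exists (Num.truncn (2 * T1 / e)).+1; split; first by rewrite ltr0n.
    by rewrite [leRHS]mulrC -ler_pdivrMr// le_nat_truncn.
  by rewrite -natr1 lerD2r truncn_le divr_ge0 ?(ltW e0)// mulr_ge0.
have mm0 : (0 < mm)%N by rewrite -(ltr0n R).
pose cg := ln (2 * mm%:R : R).
have cg0 : 0 <= cg.
  by rewrite ln_ge0// -natrM ler1n muln_gt0 mm0.
have cgE : mm%:R * expR (- cg) <= 2^-1.
  by rewrite expRN lnK ?posrE ?mulr_gt0// invfM mulrCA divff ?mulr1// gt_eqF.
have cg_le : cg <= ln C3 + ln q.+1%:R + g * LM.
  have -> : g * LM = ln (M%:R `^ g) by rewrite ln_powR.
  have q1 : 1 <= q.+1%:R :> R by rewrite ler1n.
  have q1R : 0 < q.+1%:R :> R by rewrite ltr0n.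
  rewrite -(lnM_pos C30 q1R) -(lnM_pos (mulr_gt0 C30 q1R) (powR_gt0 g MR)).
  apply: le_ln_pos; first exact: mulr_gt0.
  have qM : 1 <= q.+1%:R * M%:R `^ g.
    by rewrite (le_trans Mg1)// ler_peMl ?powR_ge0.
  have -> : C3 * q.+1%:R * M%:R `^ g =
    2 * (2 * T1 / e) + 2 * (q.+1%:R * M%:R `^ g) by rewrite /C3 /T1; ring.
  by move: mm_le; lra.
pose Wn := size (words M n l X Y).
have WnE : Wn = (cnt M X * cnt (n ^ l) Y)%N by rewrite /Wn size_allpairs.
have nl0 : (0 < n ^ l)%N by rewrite expn_gt0 n0.
have Wn0 : (0 < Wn)%N by rewrite WnE muln_gt0 !cnt_gt0.
have WnR : 0 < Wn%:R :> R by rewrite ltr0n.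
pose cb := ln (2 * Wn%:R : R).
have cb0 : 0 <= cb by rewrite ln_ge0// -natrM ler1n muln_gt0.
have cbE : Wn%:R * expR (- cb) <= 2^-1.
  by rewrite expRN lnK ?posrE ?mulr_gt0// invfM mulrCA divff ?mulr1// gt_eqF.
have cb_le : cb <= ln (2 * n%:R) + 2 * LM.
  have -> : 2 * LM = ln M%:R + ln M%:R by rewrite /LM; ring.
  have n2 : 0 < 2 * n%:R :> R by rewrite mulr_gt0.
  rewrite -(lnM_pos MR MR) -(lnM_pos n2 (mulr_gt0 MR MR)).
  apply: le_ln_pos; first exact: mulr_gt0.
  have : Wn%:R <= M%:R * (n%:R * M%:R) :> R.
    rewrite -!natrM ler_nat WnE; apply: leq_mul; first exact: cnt_le.
    exact: leq_trans (cnt_le _ _) nlM.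
  lra.
pose eta := M%:R^-1 / (`|t| * n%:R * ln n%:R).
have tn0 : 0 < `|t| * n%:R * ln n%:R by rewrite !mulr_gt0// normr_gt0.
have eta0 : 0 < eta by rewrite divr_gt0// invr_gt0.
have etaP : `|t| * n%:R * (ln n%:R * eta) <= M%:R^-1.
  by rewrite mulrA /eta mulrCA divff ?mulr1// gt_eqF.
have [G hG] := return_time irrM eta0.
(* The fixed cost of a stage: one block of rounding between the radius and [len], and the wait for
   the next stage. Spread over at least [L0] blocks it takes a third quarter. *)
pose P := s * LM + G%:R * cb.
have P0 : 0 < P by rewrite /P ltr_wpDr ?mulr_ge0// mulr_gt0.
have [L0 L0R PL0] : exists2 L0 : nat, 0 < L0%:R :> R & P / L0%:R <= kp * LM / 4.
  exists (Num.truncn (4 * P / (kp * LM))).+1; first by rewrite ltr0n.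
  rewrite ler_pdivrMr ?ltr0n// mulrAC ler_pdivlMr// [P * 4]mulrC [leRHS]mulrC.
  by rewrite -ler_pdivrMr ?mulr_gt0// le_nat_truncn.
pose d0 := s * LM + P / L0%:R.
have d00 : 0 <= d0 by rewrite addr_ge0 ?divr_ge0 ?mulr_ge0 ?(ltW s0) ?(ltW LM0) ?(ltW P0).
(* The net gain per block, at least the last quarter. *)
pose dl : R := (A' + B') * LM - cg - 2 * e * cb - d0.
have dl0 : 0 < dl.
  have h1 : 2 * e * cb <= 2 * e * (ln (2 * n%:R) + 2 * LM).
    by rewrite ler_wpM2l// mulr_ge0// (ltW e0).
  have h2 : 2 * e * (2 * LM) = kp * LM / 4 by rewrite /e; field.
  have h3 : kp * ln m%:R / 4 * q%:R = kp * LM / 4 by rewrite LME; ring.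
  have h4 : 0 < kp * LM by rewrite mulr_gt0.
  have h5 : (A' + B') * LM = g * LM + s * LM + kp * LM by rewrite /kp; ring.
  rewrite /dl /d0 h5; move: hq h1; rewrite h3; move: cg_le PL0 h2 h4; clear; lra.
have dc0 : 0 < (M ^ L0.+1)%:R^-1 :> R by rewrite invr_gt0 ltr0n expn_gt0 M0.
(* Radii at most [M^-(L0 + 1)] make every stage last at least [L0] blocks. *)
have [Bc [Brad Bcov Bsum]] := SC _ _ dc0 ltr01.
have BradM b : b \in Bc -> 0 < b.2 <= M%:R^-1.
  move=> /Brad /andP[-> h] /=; apply: (le_trans h).
  by rewrite lef_pV2 ?posrE ?ltr0n ?expn_gt0 ?M0// ler_nat expnS leq_pmulr// expn_gt0 M0.
have lenP i : (i < size Bc)%N -> (L0 <= len M Bc i)%N /\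
    - ln (rad Bc i) <= (len M Bc i).+1%:R * LM.
  move=> iB; have [r0 l0 h1 h2] := rad_bound M1 BradM iB.
  have /andP[_ h3] := Brad _ (mem_nth (0, 0) iB); rewrite -/(rad Bc i) in h3.
  split.
    rewrite -ltnS -(ltn_exp2l _ _ M1) -(ltr_nat R).
    apply: (@le_lt_trans _ _ (M ^ L0.+1)%:R).
      by rewrite ler_nat leq_exp2l.
    have u0 : 0 < (M ^ L0.+1)%:R :> R by rewrite ltr0n expn_gt0 M0.
    have v0 : 0 < (M ^ (len M Bc i).+1)%:R :> R by rewrite ltr0n expn_gt0 M0.
    move: h2 h3 u0 v0.
    move: (M ^ L0.+1)%:R (M ^ (len M Bc i).+1)%:R => u v h2 h3 u0 v0.
    have h4 : rad Bc i * u <= 1 by rewrite -ler_pdivlMr// div1r.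
    have : u * 1 < u * (v * rad Bc i) by rewrite ltr_pM2l.
    have : v * (rad Bc i * u) <= v * 1 by rewrite ler_pM2l.
    clear; lra.
  rewrite -lnV ?posrE// /LM -ln_expn//; apply: le_ln_pos; first by rewrite invr_gt0.
  by rewrite -div1r ler_pdivrMr// ltW.
pose Jm := (\max_(i < size Bc) len M Bc i)%N.
have lenm i : (i < size Bc)%N -> (len M Bc i <= Jm)%N.
  by move=> iB; exact: (leq_bigmax (Ordinal iB)).
have am i : (i < size Bc)%N ->
    - (s * ln (rad Bc i)) + G%:R * cb <= (len M Bc i)%:R * d0.
  move=> iB; have [h1 h2] := lenP i iB.
  have h3 : s * - ln (rad Bc i) <= s * ((len M Bc i).+1%:R * LM) by rewrite ler_pM2l.
  have h4 : P <= (len M Bc i)%:R * (P / L0%:R).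
    by rewrite mulrC mulrAC ler_pdivlMr// ler_pM2l// ler_nat.
  move: h3 h4; rewrite /d0 /P -natr1; clear; lra.
(* [Jm] depends on the cover, so [K] comes after it. The first summand is for truncating [K * lam]
   to [L], and [ln 2] for keeping only half of the points. *)
pose cst := `|B'| * ln n%:R + ln 2 + Jm%:R * d0 + G%:R * cb.
have [K K0 hK] : exists2 K : nat, (0 < K)%N & cst < K%:R * dl.
  exists (Num.truncn (cst / dl)).+1 => //.
  by rewrite -ltr_pdivrMr// truncnS_gt.
(* The initial phase can only increase [ypos], so [K] blocks determine the first [L] digits of [y]
   for every phase. *)
pose L := Num.truncn (K%:R * lam).
have Klam0 : 0 <= K%:R * lam by rewrite mulr_ge0// ltW.
have [E [uE sizeE sE injE]] := word_points (M ^ K) (n ^ L) X Y.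
pose I := (3 * M)%N.
have I0 : (0 < I)%N by rewrite muln_gt0.
have IR : 0 < I%:R :> R by rewrite ltr0n.
pose nb (i : nat) p := nbad M n l X Y t lam mm (i%:R / I%:R) 0 K p.
have nb_sum p : p \in E -> \sum_(i <- iota 0 I) (nb i p)%:R <= I%:R * (e * K%:R).
  move=> pE; under eq_bigr do rewrite /nb /nbad natr_count.
  rewrite exchange_big /=.
  apply: (@le_trans _ _ (\sum_(a <- iota 0 K) I%:R * e)).
    apply: ler_sum => a _; rewrite ME.
    apply: (@bad_average R m q n l X Y t A B C1 C2 g lam) => //;
      by rewrite -?ME ?(ltW lam0)//; exact: sE.
  rewrite big_const_seq count_predT size_iota iter_addr_0 -[leLHS]mulr_natl.
  by rewrite mulrC mulrA.
have eK0 : 0 < e * K%:R by rewrite mulr_gt0// ltr0n.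
have [i iI hE] := exists_good_index I0 eK0 (fun i p => ler0n R (nb i p)) nb_sum.
set E' := [seq _ <- _ | _] in hE.
have th0 : 0 <= i%:R / I%:R :> R by rewrite divr_ge0.
have th1 : i%:R / I%:R < 1 :> R by rewrite ltr_pdivrMr// mul1r ltr_nat.
have h1 : (size E')%:R <= expR (K%:R * cg + (2 * (e * K%:R)) * cb + K%:R * d0
    + Jm%:R * d0 + G%:R * cb).
  apply: (@good_points_bound R M n l X Y t M1 n1 X1 Y1 MX Yn lam lamE lam_l mm eta
    etaP cg cb cgE cbE s Bc BradM Bcov Bsum G Jm d0 cg0 cb0 d00 hG lenm am
    (i%:R / I%:R) K E' (2 * (e * K%:R)) th0 th1).
  - by rewrite filter_uniq.
  - by move=> p; rewrite mem_filter => /andP[_]; exact: sE.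
  - move=> p p'; rewrite !mem_filter => /andP[_ pE] /andP[_ p'E] [e1 e2].
    have [Xp Yp] := sE _ pE; have [Xp' Yp'] := sE _ p'E.
    have /andP[y0 _] := Y1 _ Yp; have /andP[y0' _] := Y1 _ Yp'.
    apply: injE => //.
    have Ly : (L <= ypos lam (i%:R / I%:R) K)%N.
      by apply: le_truncn; rewrite lerDl.
    apply: (@dg_coarse _ _ (n ^ (ypos lam (i%:R / I%:R) K - L))) => //.
      by rewrite expn_gt0 n0.
    by rewrite -expnD subnKC.
  - by move=> p; rewrite mem_filter => /andP[].
have h2 : (size E)%:R <= 2 * (size E')%:R :> R by rewrite -natrM ler_nat.
have MKE : (M ^ K = m ^ (q * K))%N by rewrite ME expnM.
have hX : expR (A' * (K%:R * LM)) <= (cnt (M ^ K) X)%:R.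
  by have := cX' (q * K)%N; rewrite -MKE natr_powR ?expn_gt0 ?M0// ln_expn.
have hY : expR (B' * (L%:R * ln n%:R)) <= (cnt (n ^ L) Y)%:R.
  by have := cY' L; rewrite natr_powR ?expn_gt0 ?n0// ln_expn.
have hXY : expR (A' * (K%:R * LM) + B' * (L%:R * ln n%:R)) <= (size E)%:R.
  by rewrite sizeE natrM expRD ler_pM ?expR_ge0.
have := le_trans hXY (le_trans h2 (ler_wpM2l (ler0n R 2) h1)).
rewrite -{1}(@lnK R 2) ?posrE// -expRD ler_expR.
have hL : B' * (K%:R * LM) - `|B'| * ln n%:R <= B' * (L%:R * ln n%:R).
  by rewrite -lamE [K%:R * (_ * _)]mulrA ler_mul_truncn// ltW.
move: hK hL; rewrite /cst /dl; clear; lra.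
Qed.

End LowerBound.

(** * Dimensions of the two sets and of the sumset *)

Section Dimension.
Variable R : realType.
Implicit Types (A X Y : set R).

Lemma hausdorff_dim_fin A : compact A -> A `<=` [set` `[0, 1]] ->
  exists a : R, [/\ 0 <= a, hausdorff_dim A = a%:E,
    forall s, a < s -> small_cover s A &
    forall s, 0 < s -> s < a -> ~ small_cover s A].
Proof.
(* Any exponent above 1 serves to show that the dimension is finite. *)
move=> cA A1; have A2 : small_cover 2 A.
  apply: (@small_cover_bounded R A 1) => //; last by lra.
  move=> x /A1; rewrite /= in_itv /= => /andP[x0 x1].
  by rewrite ger0_norm.
have d0 : (0 <= hausdorff_dim A)%E.
  by apply/ereal_infP => _ [s /= [s0 _] <-]; rewrite lee_fin.
have d2 : (hausdorff_dim A <= 2%:E)%E.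
  apply: ereal_inf_lbound; exists 2 => //=; split => //.
  exact: small_cover_measure0.
have dE : hausdorff_dim A = (fine (hausdorff_dim A))%:E.
  rewrite fineK// fin_numE; move: d0 d2; by case: hausdorff_dim.
exists (fine (hausdorff_dim A)); split => //.
- by rewrite -lee_fin -dE.
- move=> s hs.
  have : (hausdorff_dim A < s%:E)%E by rewrite dE lte_fin.
  move=> /ereal_inf_lt[_ [s' /= [s'0 Hs'] <-]]; rewrite lte_fin => s's.
  by apply: (measure0_small_cover s'0 (ltW s's)) => //; exact: le_lt_trans s's.
- move=> s s0 hs sc.
  have : (hausdorff_dim A <= s%:E)%E.
    apply: ereal_inf_lbound; exists s => //=; split; first exact: ltW.
    exact: small_cover_measure0.
  by rewrite dE lee_fin leNgt hs.
Qed.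

Lemma core_stable (m : nat) X : times_invariant m X -> stable m (core X).
Proof.
move=> hX z [Xz z01]; split; last by rewrite /= fr_ge0 fr_lt1.
by apply: hX; exists z.
Qed.

(** If the given point is 1, its image lies in [[0, 1[]. *)
Lemma core_nonempty (m : nat) X : X `<=` [set` `[0, 1]] -> X !=set0 ->
  times_invariant m X -> core X !=set0.
Proof.
move=> X1 [x Xx] hX; have := X1 _ Xx; rewrite /= in_itv /= => /andP[x0].
rewrite le_eqVlt => /orP[/eqP xE|x1]; last by exists x; split => //; apply/andP.
exists (times_map m x); split; last by rewrite /= fr_ge0 fr_lt1.
by apply: hX; exists x.
Qed.

(** For [a' <= 0], which can occur in dimension 0, the bound holds because there is at least one
    word. *)
Lemma cnt_lower_dim (b : nat) X (a a' : R) : (1 < b)%N -> X `<=` [set` `[0, 1]] ->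
  stable b (core X) -> core X !=set0 ->
  (forall s, 0 < s -> s < a -> ~ small_cover s X) -> a' < a ->
  forall k, (b ^ k)%:R `^ a' <= (cnt (b ^ k) (core X))%:R :> R.
Proof.
move=> b1 X1 sX X0 hX aa k; have [a0|a0] := ltP 0 a'.
  by apply: cnt_lower => //; exact: hX.
have b0 : (0 < b ^ k)%N by rewrite expn_gt0 (ltnW b1).
apply: (@le_trans _ _ 1).
  by rewrite -[leRHS](powRr0 (b ^ k)%:R) ler_powR// ler1n.
by rewrite ler1n cnt_gt0//; exact: core_unit.
Qed.

Lemma closed_unit_compact X : closed X -> X `<=` [set` `[0, 1]] -> compact X.
Proof. by move=> cX X1; exact: subclosed_compact cX (@segment_compact R 0 1) X1. Qed.

Lemma sumset_compact X Y (t : R) : compact X -> compact Y ->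
  compact [set x + t * y | x in X & y in Y].
Proof.
move=> cX cY.
have -> : [set x + t * y | x in X & y in Y] = (fun p : R * R => p.1 + t * p.2) @` (X `*` Y).
  apply/seteqP; split.
    by move=> _ [x Xx [y Yy <-]]; exists (x, y).
  by move=> _ [[x y] [/= Xx Yy] <-]; exists x => //; exists y.
apply: continuous_compact; last exact: compact_setX.
apply: continuous_subspaceT => p.
apply: cvgD; first exact: cvg_fst.
by apply: cvgM; [exact: cvg_cst|exact: cvg_snd].
Qed.

End Dimension.

Unset Implicit Arguments.
Set Strict Implicit.

Theorem mainTheorem1 (R : realType) (m n : nat)
    (hm : (2 <= m)%N) (hn : (2 <= n)%N) (hmn : ~ powers_of_same_integer m n)
    (X Y : set R) (hX0 : X !=set0) (hY0 : Y !=set0)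
    (hX01 : X `<=` [set` `[0, 1]]) (hY01 : Y `<=` [set` `[0, 1]])
    (hXc : closed X) (hYc : closed Y)
    (hX : times_invariant m X) (hY : times_invariant n Y)
    (t : R) (ht : t != 0) :
  hausdorff_dim [set x + t * y | x in X & y in Y] =
  Order.min 1%E (hausdorff_dim X + hausdorff_dim Y)%E.
Proof.
have cX := closed_unit_compact hXc hX01; have cY := closed_unit_compact hYc hY01.
have [a [a0 -> aS aN]] := hausdorff_dim_fin cX hX01.
have [b [b0 -> bS bN]] := hausdorff_dim_fin cY hY01.
have sX := core_stable hX; have sY := core_stable hY.
have X0 := core_nonempty hX01 hX0 hX; have Y0 := core_nonempty hY01 hY0 hY.
have X1 := @core_unit R X; have Y1 := @core_unit R Y.
have upX s : 0 < s -> a < s -> exists2 C : R, 0 < C &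
    forall k, (cnt (m ^ k) (core X))%:R <= C * (m ^ k)%:R `^ s.
  move=> s0 /aS scX; apply: cnt_upper => //.
  by apply: small_coverS scX => x [].
have upY s : 0 < s -> b < s -> exists2 C : R, 0 < C &
    forall k, (cnt (n ^ k) (core Y))%:R <= C * (n ^ k)%:R `^ s.
  move=> s0 /bS scY; apply: cnt_upper => //.
  by apply: small_coverS scY => x [].
rewrite -EFinD -EFin_min; apply: hausdorff_dim_char.
- by rewrite le_min ler01 addr_ge0.
- exact: sumset_compact.
- move=> s; rewrite gt_min => /orP[s1|sab].
    apply: (@small_cover_bounded R _ (1 + `|t|)) => //.
    move=> _ [x /hX01 + [y /hY01 + <-]]; rewrite /= !in_itv /=.
    move=> /andP[x0 x1] /andP[y0 y1].
    apply: (le_trans (ler_normD _ _)); apply: lerD; first by rewrite ger0_norm.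
    by rewrite normrM ler_piMr// ger0_norm.
  pose e := (s - (a + b)) / 3; have e0 : 0 < e by rewrite /e; lra.
  have [||C1 C10 h1] := upX (a + e); [lra|lra|].
  have [||C2 C20 h2] := upY (b + e); [lra|lra|].
  have a0' : 0 < a + e by lra.
  have b0' : 0 < b + e by lra.
  have := small_cover_sumset t hm hn hX01 hY01 a0' b0' C10 C20 h1 h2.
  by apply; rewrite /e; lra.
move=> s s0; rewrite lt_min => /andP[s1 sab] sc.
(* With [g] the maximum used below, [g + s < a + b - 2 e] requires [2 e < a + b - s] and
   [4 e < 1 - s]. *)
pose e := Num.min (1 - s) (a + b - s) / 8.
have me0 : 0 < Num.min (1 - s) (a + b - s) by rewrite lt_min !subr_gt0 s1.
have e0 : 0 < e by rewrite divr_gt0.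
have me1 : 8 * e <= 1 - s.
  by rewrite /e mulrC divfK// ge_min lexx.
have me2 : 8 * e <= a + b - s.
  by rewrite /e mulrC divfK// ge_min lexx orbT.
have [||C1 C10 h1] := upX (a + e); [lra|lra|].
have [||C2 C20 h2] := upY (b + e); [lra|lra|].
have h3 := @cnt_lower_dim R m X a (a - e) hm hX01 sX X0 aN.
have h4 := @cnt_lower_dim R n Y b (b - e) hn hY01 sY Y0 bN.
have irr q : (0 < q)%N -> nonresonant (ln (m ^ q)%:R / ln n%:R : R).
  by move=> q0; exact: nonresonant_ln_ratio.
have := @sumset_not_small_cover R m n (core X) (core Y) t (a + e) (b + e)
  (a - e) (b - e) C1 C2 s (Num.max 0 ((a + e) + (b + e) - 1)) hm hn ht irr X1 Y1 X0 Y0 sX sY.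
apply => //.
- lra.
- lra.
- by apply: h3; lra.
- by apply: h4; lra.
- by rewrite le_max lexx.
- by rewrite le_max lexx orbT.
- by rewrite -ltrBrDr gt_max; apply/andP; split; lra.
- by apply: small_coverS sc => _ [x [Xx _] [y [Yy _] <-]]; exists x => //; exists y.
Qed.
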